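(* Let $q$ be a prime power and let $F$ be a field of characteristic $p>0$ not dividing $q$. Let $m=m(p,q)$. Suppose that $0\le k\le n$ with $1\le n$ and $0<i<m$ are integers. Then $$\mathcal{M}^n_{k,i}\;\cong\;\mathcal{M}^{n-1}_{k,i+1}\;\oplus\;\mathcal{M}^{n-1}_{k-1,i-1}\;\oplus\;\mathcal{M}^{n-2}_{k-1,i}\,S_{n-1}$$ as $FG_{n-1}$-sequences, where $G_{n-1}=\mathrm{GL}(n-1,q)$.
   Context: For $i\ge 1$ put $[i]_q=1+q+\dots+q^{i-1}$, and let $m=m(p,q):=\min\{i>1 : [i]_q=0 \text{ in } F\}$. For integers $n\ge 0$ and $k$ let $L^n_k$ be the set of $k$-dimensional subspaces of $\mathbb{F}_q^n$ (row vectors) and let $M^n_k=FL^n_k$ be the $F$-vector space with basis $L^n_k$; $M^n_k=0$ if $k<0$ or $k>n$, and also if $n<0$. The incidence map $\partial:M^n_k\to M^n_{k-1}$ is the linear map sending $x\in L^n_k$ to the sum of all $(k-1)$-dimensional subspaces of $x$. One has $\partial^m=0$. The group $G_n=\mathrm{GL}(n,q)$ acts on $M^n_k$ by right multiplication ($G_0$ is trivial), and $\partial$ commutes with this action. For $0\le i\le m$, $\mathcal{M}^n_{k,i}$ is the sequence (chain complex) of $FG_n$-modules $$\cdots\leftarrow M^n_{k-m}\xleftarrow{\partial^{m-i}} M^n_{k-i}\xleftarrow{\partial^{i}} M^n_{k}\xleftarrow{\partial^{m-i}} M^n_{k+m-i}\xleftarrow{\partial^{i}} M^n_{k+m}\leftarrow\cdots$$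 with $M^n_{k+sm}$ in position $2s$ and $M^n_{k-i+sm}$ in position $2s-1$ ($s\in\mathbb{Z}$); $\partial^0$ is the identity. An isomorphism of $FG$-sequences is a family of $FG$-isomorphisms, one for each position, commuting with the maps of the sequences; direct sums are taken position by position. $G_{n-1}$ is regarded as the subgroup of $G_n$ of block matrices $\begin{pmatrix} 1 & 0 \\ 0 & g' \end{pmatrix}$ with $g'\in \mathrm{GL}(n-1,q)$. For an $FG_{n-2}$-module $M$ (with $n\ge2$), $M S_{n-1}$ denotes the $FG_{n-1}$-module obtained by inflating $M$ to the subgroup $A_{n-2}=\left\{\begin{pmatrix} 1 & 0 \\ a & g'' \end{pmatrix}: a\in(\mathbb{F}_q^{n-2})^T,\ g''\in G_{n-2}\right\}$ of $G_{n-1}$ along $\begin{pmatrix} 1 & 0 \\ a & g'' \end{pmatrix}\mapsto g''$, and then inducing from $A_{n-2}$ to $G_{n-1}$. (The index is $q^{n-1}-1$, and a Singer cycle $S_{n-1}$ of $G_{n-1}$, cyclic of order $q^{n-1}-1$, is a transversal.) $\mathcal{M}^{n-2}_{k-1,i}S_{n-1}$ is the sequence obtained by applying this functor to all modules and maps of $\mathcal{M}^{n-2}_{k-1,i}$; for $n=1$ it is $0$. *)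

(* Defs.v *)
From HB Require Import structures.
From mathcomp Require Import all_boot all_order all_algebra all_fingroup.
From mathcomp Require Import cyclic zify.

Set Implicit Arguments.
Unset Strict Implicit.
Unset Printing Implicit Defensive.

Import Order.TTheory GRing.Theory Num.Theory.
Import VectorInternalTheory.
Local Open Scope ring_scope.

(* The integer [i]_q; its image in F is (qnum q i)%:R. *)
Definition qnum (q i : nat) : nat := (\sum_(j < i) q ^ j)%N.

Lemma qnum_zero_exists (F : fieldType) (p q : nat) :
  p \in [pchar F] -> ~~ (p %| q)%N ->
  exists i, (1 < i)%N && ((qnum q i)%:R == 0 :> F).
Proof.
move=> chFp pNq; have p_pr := pcharf_prime chFp.
have p_gt1 := prime_gt1 p_pr.
have cqp : coprime q p by rewrite coprime_sym prime_coprime.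
exists (totient p * p)%N; apply/andP; split.
  by apply: (leq_trans p_gt1); rewrite leq_pmull // totient_gt0 prime_gt0.
set x : F := q%:R; have q1 : x ^+ (totient p) = 1.
  rewrite /x -natrX -(GRing.natr_mod_pchar chFp) Euler_exp_totient //.
  by rewrite (GRing.natr_mod_pchar chFp).
have -> : (qnum q (totient p * p))%:R = \sum_(j < totient p * p) x ^+ j.
  by rewrite /qnum natr_sum; apply: eq_bigr => j _; rewrite natrX.
have := subrX1 x (totient p * p).
rewrite exprM q1 expr1n subrr => /esym/eqP; rewrite mulf_eq0 subr_eq0.
case/orP=> [/eqP-> | //]; under eq_bigr do rewrite expr1n.
by rewrite sumr_const card_ord natrM (pcharf0 chFp) mulr0.
Qed.

(* m(p, q) = min {i > 1 : [i]_q = 0 in F} *)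
Definition mpq (F : fieldType) (p q : nat)
    (chFp : p \in [pchar F]) (pNq : ~~ (p %| q)%N) : nat :=
  ex_minn (qnum_zero_exists chFp pNq).

(* {'GL_n[K]} of matrix.v is GL_1 when n = 0; here GL K 0 is trivial. *)
Definition GL (K : finFieldType) (n : nat) := {g : 'M[K]_n | g \in unitmx}.

HB.instance Definition _ K n := SubFinite.on (GL K n).

Section GLGroup.
Variables (K : finFieldType) (n : nat).
Implicit Types g h : GL K n.

Lemma GL_mul_subproof g h : val g *m val h \in unitmx.
Proof. by rewrite unitmx_mul (valP g) (valP h). Qed.
Lemma GL_inv_subproof g : invmx (val g) \in unitmx.
Proof. by rewrite unitmx_inv (valP g). Qed.

Definition GL_one : GL K n := Sub 1%:M (unitmx1 _ _).
Definition GL_mul g h : GL K n := Sub (val g *m val h) (GL_mul_subproof g h).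
Definition GL_inv g : GL K n := Sub (invmx (val g)) (GL_inv_subproof g).

Lemma GL_mulA : associative GL_mul.
Proof. by move=> g h l; apply/val_inj; rewrite /= mulmxA. Qed.
Lemma GL_mul1 : left_id GL_one GL_mul.
Proof. by move=> g; apply/val_inj; rewrite /= mul1mx. Qed.
Lemma GL_mulV : left_inverse GL_one GL_inv GL_mul.
Proof. by move=> g; apply/val_inj; rewrite /= mulVmx ?(valP g). Qed.

HB.instance Definition _ := Finite_isGroup.Build (GL K n) GL_mulA GL_mul1 GL_mulV.
End GLGroup.

(* These instances rely on the subtype structure of {vspace vT} over matrices,
   which is only visible after importing VectorInternalTheory. *)
HB.instance Definition _ (K : finFieldType) (vT : vectType K) :=
  [Countable of {vspace vT} by <:].
HB.instance Definition _ (K : finFieldType) (vT : vectType K) :=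
  [Finite of {vspace vT} by <:].

(* A right FG-module, for a finite group G = gT. *)
Record fgmod (F : fieldType) (gT : finGroupType) := FGMod {
  fg_car :> lmodType F;
  fg_act : fg_car -> gT -> fg_car;
  fg_act1 : forall v, fg_act v 1%g = v;
  fg_actM : forall v g h, fg_act v (g * h)%g = fg_act (fg_act v g) h;
  fg_act_linear : forall g, linear (fg_act^~ g)
}.
Arguments fg_act {F gT} M v g : rename.

Record fghom (F : fieldType) (gT : finGroupType) (M N : fgmod F gT) := FGHom {
  fg_map :> M -> N;
  fg_map_linear : linear fg_map;
  fg_map_act : forall v g, fg_map (fg_act M v g) = fg_act N (fg_map v) g
}.

Section Modules.
Variable F : fieldType.

Section ZeroModule.
Variable gT : finGroupType.

Definition fg_zero_act (v : 'rV[F]_0) (g : gT) := v.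
Lemma fg_zero_act1 v : fg_zero_act v 1%g = v. Proof. by []. Qed.
Lemma fg_zero_actM v g h : fg_zero_act v (g * h)%g = fg_zero_act (fg_zero_act v g) h. Proof. by []. Qed.
Lemma fg_zero_linear g : linear (fg_zero_act^~ g).
Proof. by []. Qed.
Definition fg_zero : fgmod F gT := FGMod fg_zero_act1 fg_zero_actM fg_zero_linear.
End ZeroModule.

Section Composition.
Variables (gT : finGroupType) (M N P : fgmod F gT).
Variables (f : fghom N P) (h : fghom M N).

Lemma fg_id_linear : linear (@id M). Proof. by []. Qed.
Lemma fg_id_act v g : id (fg_act M v g) = fg_act M (id v) g. Proof. by []. Qed.
Definition fg_id : fghom M M := FGHom fg_id_linear fg_id_act.

Lemma fg_comp_linear : linear (f \o h).
Proof. by move=> a u v; rewrite /= !fg_map_linear. Qed.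
Lemma fg_comp_act v g : (f \o h) (fg_act M v g) = fg_act P ((f \o h) v) g.
Proof. by rewrite /= !fg_map_act. Qed.
Definition fg_comp : fghom M P := FGHom fg_comp_linear fg_comp_act.
End Composition.

Section DirectSum.
Variables (gT : finGroupType) (M N : fgmod F gT).

Definition fg_sum_act (v : M * N) (g : gT) : M * N :=
  (fg_act M v.1 g, fg_act N v.2 g).
Lemma fg_sum_act1 v : fg_sum_act v 1%g = v.
Proof. by case: v => v w; rewrite /fg_sum_act !fg_act1. Qed.
Lemma fg_sum_actM v g h : fg_sum_act v (g * h)%g = fg_sum_act (fg_sum_act v g) h.
Proof. by rewrite /fg_sum_act !fg_actM. Qed.
Lemma fg_sum_linear g : linear (fg_sum_act^~ g).
Proof. by move=> a u v; rewrite /= /fg_sum_act !fg_act_linear. Qed.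
Definition fg_sum : fgmod F gT := FGMod fg_sum_act1 fg_sum_actM fg_sum_linear.
End DirectSum.

Section DirectSumMap.
Variables (gT : finGroupType) (M N M' N' : fgmod F gT).
Variables (f : fghom M M') (h : fghom N N').

Definition fg_sum_fun (v : fg_sum M N) : fg_sum M' N' := (f v.1, h v.2).
Lemma fg_sum_fun_linear : linear fg_sum_fun.
Proof. by move=> a u v; rewrite /fg_sum_fun /= !fg_map_linear. Qed.
Lemma fg_sum_fun_act v g :
  fg_sum_fun (fg_act (fg_sum M N) v g) = fg_act (fg_sum M' N') (fg_sum_fun v) g.
Proof. by rewrite /= /fg_sum_act /fg_sum_fun /= !fg_map_act. Qed.
Definition fg_sum_map : fghom (fg_sum M N) (fg_sum M' N') :=
  FGHom fg_sum_fun_linear fg_sum_fun_act.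
End DirectSumMap.

(* Pullback of modules along a group morphism phi: restriction to a subgroup
   when phi is injective, inflation when phi is surjective. *)
Section Pullback.
Variables (hT gT : finGroupType) (phi : {morphism [set: hT] >-> gT}).

Section PullbackModule.
Variable M : fgmod F gT.
Definition fg_pull_fun (v : M) (h : hT) : M := fg_act M v (phi h).
Lemma fg_pull_fun1 v : fg_pull_fun v 1%g = v.
Proof. by rewrite /fg_pull_fun morph1 fg_act1. Qed.
Lemma fg_pull_funM v g h : fg_pull_fun v (g * h)%g = fg_pull_fun (fg_pull_fun v g) h.
Proof. by rewrite /fg_pull_fun morphM ?inE // fg_actM. Qed.
Lemma fg_pull_linear g : linear (fg_pull_fun^~ g).
Proof. by move=> a u v; rewrite /= /fg_pull_fun fg_act_linear. Qed.
Definition fg_pull : fgmod F hT := FGMod fg_pull_fun1 fg_pull_funM fg_pull_linear.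
End PullbackModule.

Section PullbackMap.
Variables (M N : fgmod F gT) (f : fghom M N).
Lemma fg_pull_map_act v h :
  f (fg_act (fg_pull M) v h) = fg_act (fg_pull N) (f v) h.
Proof. by rewrite /= /fg_pull_fun fg_map_act. Qed.
Definition fg_pull_map : fghom (fg_pull M) (fg_pull N) :=
  @FGHom F hT (fg_pull M) (fg_pull N) f (fg_map_linear f) fg_pull_map_act.
End PullbackMap.
End Pullback.

(* The induced module M (x)_{FA} FG, realized as the module of the functions
   u : G -> M with u (a g) a = u g for a in A: such a function stands for
   \sum_g u g (x) g, the sum being over a right transversal of A in G, and the
   condition says that u g (x) g only depends on the coset A g. *)
Section Induction.
Variables (gT : finGroupType) (A : {group gT}).

Section InducedModule.
Variable M : fgmod F (subg_of A).

Definition ind_pred : {pred {ffun gT -> M}} :=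
  fun u => [forall a : subg_of A, forall g, fg_act M (u (sgval a * g)%g) a == u g].

Lemma ind_predP (u : {ffun gT -> M}) :
  reflect (forall a g, fg_act M (u (sgval a * g)%g) a = u g) (u \in ind_pred).
Proof.
apply: (iffP forallP) => [H a g | H a]; first by have /forallP/(_ g)/eqP := H a.
by apply/forallP=> g; apply/eqP.
Qed.

Lemma ind_pred_submod : submod_closed ind_pred.
Proof.
split=> [|c u v /ind_predP uP /ind_predP vP]; apply/ind_predP=> a g.
  rewrite !ffunE; have := @fg_act_linear _ _ M a (-1) 0 0.
  by rewrite scaler0 addr0 scaleN1r addNr.
by rewrite !ffunE fg_act_linear uP vP.
Qed.
HB.instance Definition _ := GRing.isSubmodClosed.Build F {ffun gT -> M} ind_pred
  ind_pred_submod.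

Definition ind_car := {u : {ffun gT -> M} | u \in ind_pred}.
HB.instance Definition _ := SubChoice.on ind_car.
HB.instance Definition _ := [SubChoice_isSubLmodule of ind_car by <:].

(* (u h) g = u (g h^-1), as (\sum_g u g (x) g) h = \sum_g u (g h^-1) (x) g. *)
Lemma ind_act_subproof (u : ind_car) (h : gT) :
  [ffun g => val u (g * h^-1)%g] \in ind_pred.
Proof.
by apply/ind_predP=> a g; rewrite !ffunE -mulgA; apply/ind_predP/(valP u).
Qed.
Definition ind_act (u : ind_car) (h : gT) : ind_car :=
  Sub [ffun g => val u (g * h^-1)%g] (ind_act_subproof u h).
Lemma ind_act1 v : ind_act v 1%g = v.
Proof. by apply/val_inj/ffunP=> g; rewrite /= ffunE invg1 mulg1. Qed.
Lemma ind_actM v g h : ind_act v (g * h)%g = ind_act (ind_act v g) h.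
Proof. by apply/val_inj/ffunP=> x; rewrite /= !ffunE invMg mulgA. Qed.
Lemma ind_linear g : linear (ind_act^~ g).
Proof. by move=> a u v; apply/val_inj/ffunP=> x; rewrite /= !ffunE. Qed.
Definition fg_ind : fgmod F gT := FGMod ind_act1 ind_actM ind_linear.
End InducedModule.

Section InducedMap.
Variables (M N : fgmod F (subg_of A)) (f : fghom M N).
Lemma ind_fun_subproof (u : fg_ind M) : [ffun g => f (val u g)] \in ind_pred (M := N).
Proof.
apply/ind_predP=> a g; rewrite !ffunE -fg_map_act.
by congr (f _); apply/ind_predP/(valP u).
Qed.
Definition ind_fun (u : fg_ind M) : fg_ind N :=
  Sub [ffun g => f (val u g)] (ind_fun_subproof u).
Lemma ind_fun_linear : linear ind_fun.
Proof.
by move=> a u v; apply/val_inj/ffunP=> x; rewrite /= !ffunE fg_map_linear.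
Qed.
Lemma ind_fun_act u h :
  ind_fun (fg_act (fg_ind M) u h) = fg_act (fg_ind N) (ind_fun u) h.
Proof. by apply/val_inj/ffunP=> x; rewrite /= !ffunE. Qed.
Definition fg_ind_map : fghom (fg_ind M) (fg_ind N) :=
  FGHom ind_fun_linear ind_fun_act.
End InducedMap.
End Induction.

End Modules.

(* A sequence of FG-modules with positions in int, the maps lowering the
   position by one. *)
Record fgseq (F : fieldType) (gT : finGroupType) := FGSeq {
  fs_mod :> int -> fgmod F gT;
  fs_map : forall j, fghom (fs_mod j) (fs_mod (j - 1))
}.

Definition fgseq_iso (F : fieldType) (gT : finGroupType) (C D : fgseq F gT) :=
  exists f : forall j, fghom (C j) (D j),
    (forall j, bijective (f j)) /\
    (forall j v, f (j - 1) (fs_map C j v) = fs_map D j (f j v)).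

Section SequenceOperations.
Variable F : fieldType.

Definition fs_zero (gT : finGroupType) : fgseq F gT :=
  FGSeq (fun=> fg_id (fg_zero F gT)).

Definition fs_sum (gT : finGroupType) (C D : fgseq F gT) : fgseq F gT :=
  @FGSeq F gT (fun j => fg_sum (C j) (D j))
    (fun j => fg_sum_map (fs_map C j) (fs_map D j)).

Definition fs_pull (hT gT : finGroupType) (phi : {morphism [set: hT] >-> gT})
    (C : fgseq F gT) : fgseq F hT :=
  @FGSeq F hT (fun j => fg_pull phi (C j)) (fun j => fg_pull_map phi (fs_map C j)).

Definition fs_ind (gT : finGroupType) (A : {group gT})
    (C : fgseq F (subg_of A)) : fgseq F gT :=
  @FGSeq F gT (fun j => fg_ind (C j)) (fun j => fg_ind_map (fs_map C j)).
End SequenceOperations.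

Section Incidence.
Variables (F : fieldType) (K : finFieldType) (n : nat).

Definition vs_act (U : {vspace 'rV[K]_n}) (g : GL K n) : {vspace 'rV[K]_n} :=
  (linfun (mulmxr (val g)) @: U)%VS.

Definition subsp (k : int) := {U : {vspace 'rV[K]_n} | (\dim U)%:Z == k}.
HB.instance Definition _ k := SubFinite.on (subsp k).

Lemma vs_act1 U : vs_act U 1%g = U.
Proof.
rewrite /vs_act -[RHS]lim1g; congr (_ @: _)%VS.
by apply/lfunP=> v; rewrite !lfunE /= mulmx1.
Qed.
Lemma vs_actM U g h : vs_act U (g * h)%g = vs_act (vs_act U g) h.
Proof.
rewrite /vs_act -limg_comp; congr (_ @: _)%VS.
by apply/lfunP=> v; rewrite lfunE /= comp_lfunE !lfunE /= mulmxA.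
Qed.
Lemma vs_actS U V g : (vs_act U g <= vs_act V g)%VS = (U <= V)%VS.
Proof.
apply/idP/idP=> [|sUV]; last exact: limgS.
by move/(limgS (linfun (mulmxr (val g^-1%g)))); rewrite -!/(vs_act _ _) -!vs_actM mulgV !vs_act1.
Qed.
Lemma vs_act_dim U g : \dim (vs_act U g) = \dim U.
Proof.
have le V h : (\dim (vs_act V h) <= \dim V)%N.
  by rewrite -(limg_ker_dim (linfun (mulmxr (val h))) V) leq_addl.
by apply/eqP; rewrite eqn_leq le -{1}(vs_act1 U) -(mulgV g) vs_actM le.
Qed.

Section ModuleM.
Variable k : int.

Lemma subsp_act_subproof (x : subsp k) g : (\dim (vs_act (val x) g))%:Z == k.
Proof. by rewrite vs_act_dim (valP x). Qed.
Definition subsp_act (x : subsp k) (g : GL K n) : subsp k :=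
  Sub (vs_act (val x) g) (subsp_act_subproof x g).
Lemma subsp_act1 x : subsp_act x 1%g = x.
Proof. by apply/val_inj; rewrite /= vs_act1. Qed.
Lemma subsp_actM x g h : subsp_act x (g * h)%g = subsp_act (subsp_act x g) h.
Proof. by apply/val_inj; rewrite /= vs_actM. Qed.

(* The formal combination \sum_x u x *: x is represented by u; its image under
   g, \sum_x u x *: (x g), has coefficient u (x g^-1) at x. *)
Definition M_act (u : {ffun subsp k -> F^o}) (g : GL K n) :=
  [ffun x => u (subsp_act x g^-1%g)].
Lemma M_act1 u : M_act u 1%g = u.
Proof. by apply/ffunP=> x; rewrite ffunE invg1 subsp_act1. Qed.
Lemma M_actM u g h : M_act u (g * h)%g = M_act (M_act u g) h.
Proof. by apply/ffunP=> x; rewrite !ffunE invMg subsp_actM. Qed.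
Lemma M_act_linear g : linear (M_act^~ g).
Proof. by move=> a u v; apply/ffunP=> x; rewrite !ffunE. Qed.
Definition fg_M : fgmod F (GL K n) := FGMod M_act1 M_actM M_act_linear.

Definition M_basis (x : subsp k) : fg_M := [ffun y => (y == x)%:R].

Lemma M_basis_act x g : fg_act fg_M (M_basis x) g = M_basis (subsp_act x g).
Proof.
apply/ffunP=> y; rewrite [LHS]ffunE [LHS]ffunE [RHS]ffunE.
suff -> : (subsp_act y g^-1%g == x) = (y == subsp_act x g) by [].
apply/eqP/eqP=> [<-|->]; first by rewrite -subsp_actM mulVg subsp_act1.
by rewrite -subsp_actM mulgV subsp_act1.
Qed.
End ModuleM.

Section IncidenceMap.
Variable k : int.

(* The coefficient at y of the image of \sum_x u x *: x; see inc_basis. *)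
Definition inc_fun (u : fg_M k) : fg_M (k - 1) :=
  [ffun y => \sum_(x | (val y <= val x)%VS) u x].
Lemma inc_linear : linear inc_fun.
Proof.
move=> a u v; apply/ffunP=> y; rewrite !ffunE scaler_sumr -big_split.
by apply: eq_bigr => x _; rewrite !ffunE.
Qed.
Lemma inc_act u g : inc_fun (fg_act (fg_M k) u g) = fg_act (fg_M (k - 1)) (inc_fun u) g.
Proof.
apply/ffunP=> y; rewrite !ffunE (reindex (@subsp_act k ^~ g)) /=; last first.
  exists (@subsp_act k ^~ g^-1%g) => x _.
    by rewrite -subsp_actM mulgV subsp_act1.
  by rewrite -subsp_actM mulVg subsp_act1.
apply: eq_big => [x|x _].
  by rewrite -[RHS](vs_actS _ _ g) /= -vs_actM mulVg vs_act1.
by rewrite ffunE -subsp_actM mulgV subsp_act1.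
Qed.
Definition fg_inc : fghom (fg_M k) (fg_M (k - 1)) := FGHom inc_linear inc_act.

Lemma inc_basis x :
  fg_inc (M_basis x) = \sum_(y : subsp (k - 1) | (val y <= val x)%VS) M_basis y.
Proof.
apply/ffunP=> y; rewrite /= sum_ffunE ffunE.
transitivity ((val y <= val x)%VS%:R : F).
  rewrite big_mkcond (bigD1 x) //= big1 => [|z /negPf zx]; last first.
    by rewrite ffunE zx if_same.
  by rewrite ffunE eqxx addr0; case: ifP.
rewrite big_mkcond (bigD1 y) //= big1 => [|z /negPf zy]; last first.
  by rewrite ffunE eq_sym zy if_same.
by rewrite ffunE eqxx addr0; case: ifP.
Qed.
End IncidenceMap.

Section Transport.
Variables k l : int.

Definition transp_fun (u : fg_M k) : fg_M l :=
  [ffun y => if insub (val y) is Some x then u x else 0].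
Lemma transp_linear : linear transp_fun.
Proof.
move=> a u v; apply/ffunP=> y; rewrite !ffunE.
by case: insubP => [x _ _|_]; rewrite ?ffunE // scaler0 addr0.
Qed.
Lemma transp_act u g : transp_fun (fg_act (fg_M k) u g) = fg_act (fg_M l) (transp_fun u) g.
Proof.
apply/ffunP=> y; rewrite [LHS]ffunE [RHS]ffunE [RHS]ffunE.
case: insubP => [x _ xE|yNk]; last by rewrite insubN //= vs_act_dim.
rewrite [LHS]ffunE; case: insubP => [z _ zE|/negP[]]; last first.
  by rewrite /= vs_act_dim -xE (valP x).
by congr (u _); apply/val_inj; rewrite zE /= xE.
Qed.
(* The identity of M_k if k = l, and zero otherwise. *)
Definition fg_transp : fghom (fg_M k) (fg_M l) := FGHom transp_linear transp_act.
End Transport.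

Lemma fg_transp_id k (u : fg_M k) : fg_transp k k u = u.
Proof. by apply/ffunP=> y; rewrite ffunE valK. Qed.

(* The e-th power of the incidence map as a map M_k -> M_l where l = k - e; the
   target is a separate argument to avoid casts along equalities in int (for
   other values of l this is zero). *)
Fixpoint fg_incX (e : nat) (k l : int) : fghom (fg_M k) (fg_M l) :=
  if e is e'.+1 then fg_comp (fg_incX e' (k - 1) l) (fg_inc k) else fg_transp k l.

Section SequenceM.
Variables (m : nat) (k : int) (i : nat).

(* Position 2s carries M_{k + s m} and position 2s - 1 carries M_{k - i + s m}. *)
Definition seqM_dim (j : int) : int :=
  if (2 %| j)%Z then k + (j %/ 2)%Z * m%:Z
  else k - i%:Z + ((j + 1) %/ 2)%Z * m%:Z.
Definition seqM_exp (j : int) : nat := if (2 %| j)%Z then i else (m - i)%N.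

Lemma seqM_dim_pred j : (i <= m)%N ->
  seqM_dim (j - 1) = seqM_dim j - (seqM_exp j)%:Z.
Proof.
move=> le_im; rewrite /seqM_dim /seqM_exp.
have [s [->|->]] : exists s, j = s * 2 \/ j = s * 2 + 1.
  exists (j %/ 2)%Z; rewrite {1 3}(divz_eq j 2).
  have := modz_ge0 j (isT : 2 != 0 :> int).
  have := @ltz_pmod j 2 isT; lia.
- have -> : (2 %| s * 2 - 1)%Z = false by lia.
  have -> : (2 %| s * 2)%Z by lia.
  have -> : ((s * 2 - 1 + 1) %/ 2)%Z = s by lia.
  have -> : ((s * 2) %/ 2)%Z = s by lia.
  by lia.
have -> : (2 %| s * 2 + 1)%Z = false by lia.
have -> : (2 %| s * 2 + 1 - 1)%Z by lia.
have -> : ((s * 2 + 1 + 1) %/ 2)%Z = s + 1 by lia.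
have -> : ((s * 2 + 1 - 1) %/ 2)%Z = s by lia.
by rewrite mulrDl mul1r -subzn //; lia.
Qed.

Definition seqM : fgseq F (GL K n) :=
  @FGSeq F (GL K n) (fun j => fg_M (seqM_dim j))
    (fun j => fg_incX (seqM_exp j) (seqM_dim j) (seqM_dim (j - 1))).
End SequenceM.

End Incidence.

Section Subgroups.
Variables (K : finFieldType) (n : nat).

(* The embedding g' |-> block_mx 1 0 0 g' of GL_n into GL_{n+1}. *)
Lemma GL_embed_subproof (g : GL K n) :
  (block_mx 1%:M 0 0 (val g) : 'M[K]_(1 + n)) \in unitmx.
Proof. by rewrite unitmxE det_ublock det1 mul1r -unitmxE (valP g). Qed.
Definition GL_embed (g : GL K n) : GL K n.+1 :=
  Sub (block_mx 1%:M 0 0 (val g) : 'M[K]_(1 + n)) (GL_embed_subproof g).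
Lemma GL_embedM : {in [set: GL K n] &, {morph GL_embed : g h / (g * h)%g}}.
Proof.
move=> g h _ _; apply/val_inj; rewrite /= (@mulmx_block _ 1 n 1 n 1 n).
by rewrite !mul0mx !mulmx0 mul1mx !addr0 add0r.
Qed.
Canonical GL_embed_morphism := Morphism GL_embedM.

(* The group of the matrices block_mx 1 0 a g'' in GL_{n+1}. *)
Definition Aff : {set GL K n.+1} :=
  [set g | (ulsubmx (val g : 'M_(1 + n)) == 1%:M) &&
           (ursubmx (val g : 'M_(1 + n)) == 0)].
Lemma AffP (g : GL K n.+1) : g \in Aff ->
  val g = block_mx 1%:M 0 (dlsubmx (val g : 'M_(1 + n))) (drsubmx (val g : 'M_(1 + n))).
Proof.
by rewrite inE => /andP[/eqP <- /eqP <-]; rewrite (@submxK _ 1 n 1 n).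
Qed.
Lemma Aff_mul (g h : GL K n.+1) : g \in Aff -> h \in Aff ->
  val (g * h)%g = block_mx 1%:M 0
    (dlsubmx (val g : 'M_(1 + n)) + drsubmx (val g : 'M_(1 + n)) *m dlsubmx (val h : 'M_(1 + n)))
    (drsubmx (val g : 'M_(1 + n)) *m drsubmx (val h : 'M_(1 + n))).
Proof.
move=> gA hA; rewrite /= {1}(AffP gA) {1}(AffP hA) (@mulmx_block _ 1 n 1 n 1 n).
by rewrite !mul0mx !mulmx0 !mulmx1 !addr0 add0r.
Qed.
Lemma Aff_group_set : group_set Aff.
Proof.
apply/group_setP; split=> [|g h gA hA].
  by rewrite inE /= (@scalar_mx_block _ 1 n) block_mxKul block_mxKur !eqxx.
by rewrite inE Aff_mul // block_mxKul block_mxKur !eqxx.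
Qed.
Canonical Aff_group := Group Aff_group_set.

(* The projection block_mx 1 0 a g'' |-> g''. *)
Lemma Aff_proj_subproof (g : subg_of Aff_group) :
  drsubmx (val (sgval g) : 'M[K]_(1 + n)) \in unitmx.
Proof.
have := valP (sgval g); rewrite (AffP (subgP g)) unitmxE (@det_lblock _ 1 n) det1 mul1r.
by rewrite block_mxKdr -unitmxE.
Qed.
Definition Aff_proj (g : subg_of Aff_group) : GL K n :=
  Sub (drsubmx (val (sgval g) : 'M[K]_(1 + n))) (Aff_proj_subproof g).
Lemma Aff_projM :
  {in [set: subg_of Aff_group] &, {morph Aff_proj : g h / (g * h)%g}}.
Proof.
move=> g h _ _; apply/val_inj.
by rewrite [LHS]/= -[X in drsubmx X]/(val (sgval g * sgval h)%g) Aff_mul ?subgP // block_mxKdr.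
Qed.
Canonical Aff_proj_morphism := Morphism Aff_projM.
End Subgroups.

(* Inflation to Aff, then induction to GL_{n+1}. *)
Definition fs_singer (F : fieldType) (K : finFieldType) (n : nat)
    (C : fgseq F (GL K n)) : fgseq F (GL K n.+1) :=
  fs_ind (fs_pull (Aff_proj_morphism K n) C).

(* The sequence M^{n-1}_{k,i} S_n of FG_n-modules; it is zero for n = 0. *)
Definition seqM_singer (F : fieldType) (K : finFieldType) (n m : nat) (k : int)
    (i : nat) : fgseq F (GL K n) :=
  match n with
  | 0 => fs_zero F (GL K 0)
  | n'.+1 => fs_singer (seqM F K n' m k i)
  end.

(* Main.v *)
(* Let e be the first vector of V = K^(n+1), so that V = <e> + W with W = K^n.  A
   subspace x not containing e is the graph of a linear form f on its projection
   z to W; a subspace containing e is <e> + y with y in W.  For w in z put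
   S u (w, z) = sum over the x above z of u x ([f w = 1] - [f w = 0]).
   - For fixed z the kernel [f w = 1] - [f w = 0] is invertible, with inverse
     proportional to [f w = 1] - 1/q; it plays the role of a Fourier kernel but
     needs no root of unity in F.  Hence u is determined by S u and by its values
     on the subspaces containing e.
   - S commutes with the incidence map, except that for w = 0 the value
     q^(k-1) u(<e> + z) appears.  The pairs (w, z) with 0 <> w in z are permuted by
     GL_n with w transitively, and the z containing w correspond to the subspaces
     of W / <w>: this gives the summand induced from the affine group.
   - What is left is M_k + M_(k-1) with the map (a, b) |-> (d a + q^(k-1) b, d b),
     whose power of exponent i is (a, b) |-> (d^i a + c d^(i-1) b, d^i b) with
     c = q^(k-i) [i].  As c is invertible, b |-> b + c^-1 d a (and
     b |-> d a - c b in the odd positions) diagonalizes it; consecutive changes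
     of coordinates agree because [m - i] = - q^(m-i) [i] and q^m = 1 in F. *)
From HB Require Import structures.
Require Import Defs.
From mathcomp Require Import all_boot all_order all_algebra all_fingroup.
From mathcomp Require Import zify ring.

Set Implicit Arguments.
Unset Strict Implicit.
Unset Printing Implicit Defensive.

Import Order.TTheory GRing.Theory Num.Theory.

Local Open Scope ring_scope.

(** * A Fourier kernel without roots of unity *)

Section Orthogonality.
Variables (K : finFieldType) (F : fieldType).
Hypothesis q_neq0 : #|K|%:R != 0 :> F.
Local Notation q := (#|K|%:R : F).

Definition pairing d (x : 'rV[K]_d) (c : 'cV[K]_d) : K := (x *m c) 0 0.

Lemma pairingDl d (x y : 'rV[K]_d) c : pairing (x + y) c = pairing x c + pairing y c.
Proof. by rewrite /pairing mulmxDl mxE. Qed.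
Lemma pairingZl d a (x : 'rV[K]_d) c : pairing (a *: x) c = a * pairing x c.
Proof. by rewrite /pairing -scalemxAl mxE. Qed.
Lemma pairingBr d (x : 'rV[K]_d) c c' : pairing x (c - c') = pairing x c - pairing x c'.
Proof. by rewrite /pairing mulmxBr !mxE. Qed.
Lemma pairingZr d (x : 'rV[K]_d) a c : pairing x (a *: c) = a * pairing x c.
Proof. by rewrite /pairing -scalemxAr mxE. Qed.
Lemma pairing0r d (x : 'rV[K]_d) : pairing x 0 = 0.
Proof. by rewrite /pairing mulmx0 mxE. Qed.
Lemma pairing_tr d (x : 'rV[K]_d) c : pairing c^T x^T = pairing x c.
Proof. by rewrite /pairing -trmx_mul mxE. Qed.

Lemma pairing_eq1 d (c : 'cV[K]_d) : c != 0 -> exists x, pairing x c = 1.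
Proof.
case/cV0Pn=> i ci; exists ((c i 0)^-1 *: delta_mx 0 i).
by rewrite pairingZl /pairing -rowE mxE mulVf.
Qed.

(** A nonzero linear form takes every value q^(d-1) times. Averaging over translates along a vector
    on which the form is 1 lets the inner sum run over all of [K]. *)
Lemma sum_pairing d (c : 'cV[K]_d) (phi : K -> F) : c != 0 ->
  \sum_x phi (pairing x c) = q ^+ d / q * \sum_a phi a.
Proof.
case/pairing_eq1=> x1 x1c; apply: (mulfI q_neq0).
rewrite mulrA [q * (_ / _)]mulrC divfK //.
transitivity (\sum_(a : K) \sum_x phi (pairing (x + a *: x1) c)).
  rewrite mulr_natl -sumr_const; apply: eq_bigr => a _.
  by rewrite (reindex_inj (addIr (a *: x1))).
rewrite exchange_big /=.
transitivity (\sum_(x : 'rV[K]_d) \sum_a phi a).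
  apply: eq_bigr => x _; rewrite [RHS](reindex_inj (addrI (pairing x c))).
  by apply: eq_bigr => a _; rewrite pairingDl pairingZl x1c mulr1.
by rewrite sumr_const card_mx mul1n -[_ *+ (_ ^ _)]mulr_natl natrX.
Qed.

(** The same averaging, along a vector killed by [c']: the factor [psi] stays constant while the
    argument of [phi] runs through [K]. *)
Lemma sum_pairing2 d (c c' : 'cV[K]_d) (phi psi : K -> F) :
    \sum_a phi a = 0 -> (exists2 x, pairing x c = 1 & pairing x c' = 0) ->
  \sum_x phi (pairing x c) * psi (pairing x c') = 0.
Proof.
move=> phi0 [x1 x1c x1c']; apply: (mulfI q_neq0); rewrite mulr0.
transitivity (\sum_(a : K) \sum_x
    phi (pairing (x + a *: x1) c) * psi (pairing (x + a *: x1) c')).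
  rewrite mulr_natl -sumr_const; apply: eq_bigr => a _.
  by rewrite (reindex_inj (addIr (a *: x1))).
rewrite exchange_big big1 // => x _.
under eq_bigr => a _ do rewrite !pairingDl !pairingZl x1c x1c' mulr0 addr0 mulr1.
by rewrite -mulr_suml -(reindex_inj (addrI (pairing x c)) (P := xpredT)) /= phi0 mul0r.
Qed.

Lemma sum_delta (phi : K -> F) b : \sum_a (a == b)%:R * phi a = phi b.
Proof.
rewrite (bigD1 b) //= eqxx mul1r big1 ?addr0 // => a /negPf->.
by rewrite mul0r.
Qed.

(* A substitute for a nontrivial additive character of K (which F may lack): a
   function on K together with a dual one, for which sum_pairing_dual holds. *)
Definition unit_diff (a : K) : F := (a == 1)%:R - (a == 0)%:R.
Definition unit_dual (a : K) : F := (a == 1)%:R - q^-1.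

Lemma sum_unit_diff : \sum_a unit_diff a = 0.
Proof.
have one b : \sum_(a : K) (a == b)%:R = 1 :> F.
  rewrite -[RHS](sum_delta (fun=> 1) b).
  by apply: eq_bigr => a _; rewrite mulr1.
by rewrite /unit_diff sumrB !one subrr.
Qed.

Lemma unit_diff0 : unit_diff 0 = -1.
Proof. by rewrite /unit_diff eqxx eq_sym oner_eq0 sub0r. Qed.

(** The delta in [unit_dual] contributes [unit_diff t]. The constant subtracts the mean of
    [unit_diff (t * a)] over a, which is 0 for t <> 0 and -1 for t = 0. *)
Lemma sum_unit_diff_dual t :
  \sum_a unit_diff (t * a) * unit_dual a = (t == 1)%:R.
Proof.
transitivity (unit_diff t - q^-1 * \sum_a unit_diff (t * a)).
  rewrite mulr_sumr -[in unit_diff t](mulr1 t) -(sum_delta (fun a => unit_diff (t * a))).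
  by rewrite -sumrB; apply: eq_bigr => a _; rewrite /unit_dual; ring.
have [->|t0] := eqVneq t 0.
  under eq_bigr do rewrite mul0r.
  rewrite sumr_const -[unit_diff 0 *+ _]mulr_natl mulrA mulVf // mul1r subrr.
  by rewrite eq_sym oner_eq0.
rewrite -(reindex_inj (mulfI t0) (P := xpredT)) /= sum_unit_diff mulr0 subr0.
by rewrite /unit_diff (negPf t0) subr0.
Qed.

(** If [c] is a multiple of a nonzero [c'], the sum reduces to one variable. If some vector is
    killed by [c'] but not by [c], the sum vanishes. Only c = c' = 0 remains, with constant summand
    1/q. *)
Lemma sum_pairing_dual d (c c' : 'cV[K]_d) :
  \sum_x unit_diff (pairing x c) * unit_dual (pairing x c') = q ^+ d / q * (c == c')%:R.
Proof.
have [c'0|c'n0] := eqVneq c' 0.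
  rewrite {c'}c'0; have [->|cn0] := eqVneq c 0.
    under eq_bigr do rewrite !pairing0r unit_diff0 /unit_dual eq_sym oner_eq0.
    by rewrite sumr_const card_mx mul1n -[_ *+ (_ ^ _)]mulr_natl natrX mulr1 sub0r mulN1r opprK.
  rewrite mulr0 sum_pairing2 ?sum_unit_diff //.
  by have [x xc] := pairing_eq1 cn0; exists x => //; rewrite pairing0r.
have [x1 x1c'] := pairing_eq1 c'n0; set t := pairing x1 c.
have [ct|] := eqVneq c (t *: c').
  under eq_bigr do rewrite {1}ct pairingZr.
  rewrite (sum_pairing (fun a => unit_diff (t * a) * unit_dual a)) //.
  rewrite sum_unit_diff_dual; congr (_ * (_ : bool)%:R).
  rewrite ct -[X in _ = (_ == X)]scale1r -subr_eq0 -[RHS]subr_eq0 -scalerBl.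
  by rewrite scaler_eq0 (negPf c'n0) orbF.
rewrite -subr_eq0 => /pairing_eq1[x2]; rewrite pairingBr pairingZr => x2c.
rewrite sum_pairing2 ?sum_unit_diff //; last first.
  (* The correction along [x1] kills the pairing with [c']; the pairing with [c] becomes that of
     [x2] with [c - t *: c'], which is 1. *)
  exists (x2 - pairing x2 c' *: x1); rewrite -scaleNr pairingDl pairingZl.
    by rewrite -x2c -/t; ring.
  by rewrite x1c' mulr1 subrr.
suff /negPf-> : c != c' by rewrite mulr0.
apply/eqP=> cc'; move: x2c; rewrite /t cc' x1c' mul1r subrr.
by move/eqP; rewrite eq_sym oner_eq0.
Qed.

Lemma sum_pairing_dualr d (x x' : 'rV[K]_d) :
  \sum_c unit_diff (pairing x c) * unit_dual (pairing x' c) = q ^+ d / q * (x == x')%:R.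
Proof.
rewrite -(inj_eq trmx_inj) -sum_pairing_dual (reindex (@trmx K 1 d)); last first.
  by apply: onW_bij; exists trmx; apply: trmxK.
by apply: eq_bigr => c _; rewrite -(pairing_tr x) -(pairing_tr x') trmxK.
Qed.

End Orthogonality.

(** * Subspaces and graphs *)

Section Subspaces.
Variables (K : finFieldType) (n : nat).
Implicit Types (U X : {vspace 'rV[K]_n.+1}) (y z : {vspace 'rV[K]_n}).
Implicit Types (v : 'rV[K]_n.+1) (w : 'rV[K]_n) (a : K).

Definition cons_row a w : 'rV[K]_n.+1 := row_mx (a%:M : 'M_1) w.
Definition drop_head : 'Hom('rV[K]_n.+1, 'rV[K]_n) :=
  linfun (mulmxr (col_mx 0 1%:M : 'M_(1 + n, n)) : 'rV_(1 + n) -> 'rV_n).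

(** With e = [apex], [base] is the projection to W along e, and [cone y] is <e> + y. *)
Definition base U := (drop_head @: U)%VS.
Definition cone y := (drop_head @^-1: y)%VS.
Definition apex := cons_row 1 0.

Lemma drop_headE a w : drop_head (cons_row a w) = w.
Proof. by rewrite lfunE /= (@mul_row_col _ 1 1 n) mulmx0 mulmx1 add0r. Qed.

Lemma row_consP v : exists a, v = cons_row a (drop_head v).
Proof.
suff vE : v = cons_row (lsubmx (v : 'rV_(1 + n)) 0 0) (rsubmx (v : 'rV_(1 + n))).
  by exists (lsubmx (v : 'rV_(1 + n)) 0 0); rewrite [v in drop_head v]vE drop_headE.
by rewrite /cons_row -mx11_scalar (@hsubmxK _ 1 1 n).
Qed.

Lemma cons_rowD a b w w' : cons_row a w + cons_row b w' = cons_row (a + b) (w + w').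
Proof. by rewrite /cons_row (@add_row_mx _ 1 1 n) -raddfD. Qed.

Lemma cons_rowZ a b w : a *: cons_row b w = cons_row (a * b) (a *: w).
Proof. by rewrite /cons_row (@scale_row_mx _ 1 1 n) scale_scalar_mx. Qed.

Lemma mem_cone a w y : (cons_row a w \in cone y) = (w \in y).
Proof. by rewrite -memv_preim drop_headE. Qed.

Lemma apex_cone y : apex \in cone y.
Proof. by rewrite mem_cone mem0v. Qed.

Lemma mem_baseP U w : reflect (exists a, cons_row a w \in U) (w \in base U).
Proof.
apply: (iffP memv_imgP) => [[v vU ->]|[a aU]].
  by have [a va] := row_consP v; exists a; rewrite -va.
by exists (cons_row a w); rewrite ?drop_headE.
Qed.

Lemma baseS U X : (U <= X)%VS -> (base U <= base X)%VS.
Proof. exact: limgS. Qed.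

Lemma base_cone y : base (cone y) = y.
Proof.
apply/vspaceP=> w; apply/mem_baseP/idP=> [[a]|wy]; first by rewrite mem_cone.
by exists 0; rewrite mem_cone.
Qed.

Lemma sub_cone U y : (U <= cone y)%VS = (base U <= y)%VS.
Proof.
apply/subvP/subvP=> [sUy w /mem_baseP[a /sUy]|sUy v vU]; first by rewrite mem_cone.
have [a va] := row_consP v; rewrite va mem_cone; apply: sUy.
by apply/mem_baseP; exists a; rewrite -va.
Qed.

Lemma cone_base U : apex \in U -> cone (base U) = U.
Proof.
move=> eU; apply/eqP; rewrite eqEsubv sub_cone subvv andbT.
apply/subvP=> v; have [a ->] := row_consP v; rewrite mem_cone => /mem_baseP[b bU].
rewrite -[a](subrK b) -[drop_head v]add0r -cons_rowD rpredD // ?add0r //.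
by rewrite -[a - b]mulr1 -[0](scaler0 _ (a - b)) -cons_rowZ rpredZ.
Qed.

Lemma mem_lker_drop v : (v \in lker drop_head) = (v \in <[apex]>%VS).
Proof.
rewrite memv_ker; apply/eqP/vlineP=> [v0|[a ->]].
  have [a va] := row_consP v; exists a; rewrite va v0 cons_rowZ.
  by rewrite mulr1 scaler0.
by rewrite cons_rowZ drop_headE scaler0.
Qed.

Lemma apex_neq0 : apex != 0.
Proof.
apply/eqP=> /(congr1 (fun v : 'rV_(1 + n) => v 0 (lshift n 0))).
by rewrite row_mxEl !mxE eqxx => /eqP; rewrite oner_eq0.
Qed.

Lemma dim_cone y : \dim (cone y) = (\dim y).+1.
Proof.
rewrite -(limg_ker_dim drop_head) -/(base _) base_cone -[RHS]add1n; congr (_ + _)%N.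
rewrite (_ : _ :&: _ = <[apex]>)%VS; first by rewrite dim_vline apex_neq0.
apply/vspaceP=> v; rewrite memv_cap mem_lker_drop andb_idl // => /vlineP[a ->].
by rewrite rpredZ ?apex_cone.
Qed.

Lemma dim_base U : apex \notin U -> \dim (base U) = \dim U.
Proof.
move=> eU; apply: limg_dim_eq; apply/eqP; rewrite -subv0; apply/subvP=> v.
rewrite memv_cap mem_lker_drop memv0 => /andP[vU /vlineP[a va]]; move: vU.
by rewrite va rpredZeq (negPf eU) orbF => /eqP->; rewrite scale0r.
Qed.

Lemma dim_base_apex U : apex \in U -> \dim U = (\dim (base U)).+1.
Proof. by move/cone_base=> {1}<-; rewrite dim_cone. Qed.

Section Graph.
Variable d : nat.
Implicit Types (B : 'M[K]_(d, n)) (c : 'cV[K]_d).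

(** When the rows of [B] form a basis of z, a column [c] lists the values of a linear form on this
    basis, and [graph B c] is the graph of that form. Thus ['cV_d] parametrizes the graphs over
    z. *)
Definition rowspan B := limg (linfun (mulmxr B : 'rV_d -> 'rV_n)).
Definition graph B c : {vspace 'rV[K]_n.+1} :=
  limg (linfun (mulmxr (row_mx c B : 'M_(d, 1 + n)) : 'rV_d -> 'rV_(1 + n))).

Lemma mem_rowspanP B w : reflect (exists x, w = x *m B) (w \in rowspan B).
Proof.
apply: (iffP memv_imgP) => [[x _ ->]|[x ->]]; exists x; rewrite ?lfunE ?memvf //.
Qed.

Lemma mem_graphP B c v :
  reflect (exists x, v = cons_row (pairing x c) (x *m B)) (v \in graph B c).
Proof.
have E x : x *m (row_mx c B : 'M_(d, 1 + n)) = cons_row (pairing x c) (x *m B).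
  by rewrite (@mul_mx_row _ 1 d 1 n) /cons_row [x *m c]mx11_scalar.
apply: (iffP memv_imgP) => [[x _ ->]|[x ->]]; exists x; rewrite ?lfunE ?memvf //=.
Qed.

Lemma base_graph B c : base (graph B c) = rowspan B.
Proof.
apply/vspaceP=> w; apply/mem_baseP/mem_rowspanP=> [[a /mem_graphP[x E]]|[x ->]].
  by exists x; move/(congr1 drop_head): E; rewrite !drop_headE.
by exists (pairing x c); apply/mem_graphP; exists x.
Qed.

Lemma cons_row_inj a b w w' : cons_row a w = cons_row b w' -> a = b /\ w = w'.
Proof.
move/(@eq_row_mx _ 1 1 n)=> [/matrixP/(_ 0 0) E ->].
by move: E; rewrite !mxE eqxx.
Qed.

Variable B : 'M[K]_(d, n).
Hypothesis freeB : row_free B.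

Lemma mem_graph c x a : (cons_row a (x *m B) \in graph B c) = (a == pairing x c).
Proof.
apply/mem_graphP/eqP=> [[x' /cons_row_inj[-> /(row_free_inj freeB)->]]|->] //.
by exists x.
Qed.

Lemma graph_inj : injective (graph B).
Proof.
move=> c c' E; apply/matrixP=> i j; rewrite ord1.
have : cons_row (pairing (delta_mx 0 i) c) (delta_mx 0 i *m B) \in graph B c'.
  by rewrite -E mem_graph.
by rewrite mem_graph /pairing -!rowE !mxE => /eqP.
Qed.

Lemma apex_graph c : apex \notin graph B c.
Proof.
by rewrite /apex -(mul0mx 1 B) mem_graph /pairing mul0mx mxE oner_eq0.
Qed.

Lemma dim_rowspan : \dim (rowspan B) = d.
Proof.
rewrite limg_dim_eq ?dimvf ?/dim /= ?mul1n //.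
apply/eqP; rewrite capfv -subv0; apply/subvP=> x.
rewrite memv_ker lfunE /= memv0 => /eqP xB; apply/eqP.
by apply: (row_free_inj freeB); rewrite xB mul0mx.
Qed.

Lemma dim_graph c : \dim (graph B c) = d.
Proof. by rewrite -dim_base ?apex_graph // base_graph dim_rowspan. Qed.

(** Lifting each row of [B] to a vector of [U] gives the values of the form; its graph lies in [U]
    and has the same dimension. *)
Lemma graph_of_base U :
  base U = rowspan B -> \dim U = d -> exists c, U = graph B c.
Proof.
move=> bU dU; have rowB i : exists a, cons_row a (row i B) \in U.
  by apply/mem_baseP; rewrite bU; apply/mem_rowspanP; exists (delta_mx 0 i); rewrite rowE.
pose c := \col_i xchoose (rowB i); exists c; apply/esym/eqP.
rewrite eqEdim dU dim_graph leqnn andbT; apply/subvP=> v /mem_graphP[x ->].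
rewrite (_ : cons_row _ _ = \sum_i x 0 i *: cons_row (c i 0) (row i B)); last first.
  have sum_cons r (f : 'I_d -> K) (g : 'I_d -> 'rV_n) :
      \sum_(i <- r) cons_row (f i) (g i) = cons_row (\sum_(i <- r) f i) (\sum_(i <- r) g i).
    elim/big_rec3: _ => [|i a b w _ ->]; last by rewrite cons_rowD.
    by rewrite /cons_row raddf0 row_mx0.
  under eq_bigr do rewrite cons_rowZ.
  by rewrite sum_cons mulmx_sum_row /pairing mxE.
by apply: rpred_sum => i _; rewrite rpredZ // mxE (xchooseP (rowB i)).
Qed.

End Graph.

Lemma rowspan_basis z : exists2 B : 'M[K]_(\dim z, n), row_free B & rowspan B = z.
Proof.
pose B := \matrix_(i < \dim z) (vbasis z)`_i.
have BE x : x *m B = \sum_i x 0 i *: (vbasis z)`_i.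
  by rewrite mulmx_sum_row; apply: eq_bigr => i _; rewrite rowK.
exists B.
  apply: inj_row_free => x; rewrite BE => xB0.
  have x0 := elimT (@freeP _ _ _ _) (basis_free (vbasisP z)) (fun i => x 0 i) xB0.
  by apply/rowP=> i; rewrite x0 mxE.
apply/vspaceP=> w; apply/mem_rowspanP/idP=> [[x ->]|wz].
  rewrite BE rpred_sum // => i _; rewrite rpredZ // vbasis_mem // mem_nth //.
  by rewrite size_tuple.
exists (\row_i coord (vbasis z) i w); rewrite BE [LHS](coord_vbasis wz).
by apply: eq_bigr => i _; rewrite mxE.
Qed.

End Subspaces.

(** * The embedded linear group acting on bases and cones *)

Section Action.
Variables (K : finFieldType).

Lemma mem_vs_act n (U : {vspace 'rV[K]_n}) (g : GL K n) v :
  (v *m val g \in vs_act U g) = (v \in U).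
Proof.
apply/memv_imgP/idP=> [[u uU]|vU]; last by exists v; rewrite // lfunE.
by rewrite lfunE /= => /(can_inj (mulmxK (valP g)))->.
Qed.

Lemma mem_vs_actV n (U : {vspace 'rV[K]_n}) (g : GL K n) v :
  (v \in vs_act U g) = (v *m val g^-1%g \in U).
Proof. by rewrite -(mem_vs_act U g) /= mulmxKV ?(valP g). Qed.

Lemma cons_row_embed n a (w : 'rV[K]_n) (g : GL K n) :
  cons_row a w *m val (GL_embed g) = cons_row a (w *m val g).
Proof.
rewrite /= /cons_row (@mul_row_block _ 1 1 n 1 n).
by rewrite !mulmx0 mulmx1 addr0 add0r.
Qed.

Lemma mem_act_embed n a (w : 'rV[K]_n) (U : {vspace 'rV[K]_n.+1}) (g : GL K n) :
  (cons_row a w \in vs_act U (GL_embed g)) = (cons_row a (w *m val g^-1%g) \in U).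
Proof.
rewrite -(mem_vs_act U (GL_embed g)) cons_row_embed /=.
by rewrite mulmxKV ?(valP g).
Qed.

Lemma base_act n (U : {vspace 'rV[K]_n.+1}) (g : GL K n) :
  base (vs_act U (GL_embed g)) = vs_act (base U) g.
Proof.
apply/vspaceP=> w; rewrite mem_vs_actV.
by apply/mem_baseP/mem_baseP=> -[a aU]; exists a; move: aU; rewrite mem_act_embed.
Qed.

Lemma cone_act n (y : {vspace 'rV[K]_n}) (g : GL K n) :
  vs_act (cone y) (GL_embed g) = cone (vs_act y g).
Proof.
rewrite -[LHS]cone_base ?base_act ?base_cone //.
by rewrite /apex mem_act_embed mul0mx apex_cone.
Qed.

Lemma dim_neq_base n k (x : subsp K n.+1 k) :
  ((\dim (base (val x)))%:Z == k) = (apex K n \notin val x).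
Proof.
have /eqP dx := valP x; have [ax|ax] := boolP (apex K n \in val x).
  by apply/negbTE/eqP; have := dim_base_apex ax; lia.
by rewrite dim_base // (valP x).
Qed.

Lemma dim_base_subsp n k (x : subsp K n.+1 k) : apex K n \in val x ->
  (\dim (base (val x)))%:Z = k - 1.
Proof. by move=> ax; have := dim_base_apex ax; have /eqP := valP x; lia. Qed.

Lemma subsp_act_inj n k (g : GL K n) : injective (fun x : subsp K n k => subsp_act x g).
Proof.
apply: (can_inj (g := fun x => subsp_act x g^-1%g)) => x.
by rewrite -subsp_actM mulgV subsp_act1.
Qed.

Lemma vs_act_inj n (g : GL K n) : injective (fun U => vs_act U g).
Proof.
by apply: (can_inj (g := fun U => vs_act U g^-1%g)) => U; rewrite -vs_actM mulgV vs_act1.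
Qed.

End Action.

(** * Sums over subspaces of given dimension *)

Section Sums.
Variables (K : finFieldType) (F : fieldType).

Lemma sum_subsp n k (P : pred {vspace 'rV[K]_n}) (phi : {vspace 'rV[K]_n} -> F) :
  \sum_(x : subsp K n k | P (val x)) phi (val x) =
    \sum_(U | ((\dim U)%:Z == k) && P U) phi U.
Proof.
rewrite [RHS](reindex_omap val (insub : _ -> option (subsp K n k))).
  by apply: eq_bigl => x; rewrite valK eqxx (valP x) andbT.
by move=> U /andP[dU _]; rewrite insubT.
Qed.

(** A subspace above a cone contains the apex, hence is itself the cone over its base, of dimension
    one less. *)
Lemma sum_cone n k (y : {vspace 'rV[K]_n}) (phi : {vspace 'rV[K]_n.+1} -> F) :
  \sum_(x : subsp K n.+1 k | (cone y <= val x)%VS) phi (val x) =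
    \sum_(z : subsp K n (k - 1) | (y <= val z)%VS) phi (cone (val z)).
Proof.
rewrite (sum_subsp _ (fun x => cone y <= x)%VS phi).
rewrite (sum_subsp _ (fun z => y <= z)%VS (phi \o @cone K n)).
rewrite (reindex_onto (@cone K n) (@base K n)) => [|U /andP[_ /subvP yU]]; last first.
  by rewrite cone_base // yU ?apex_cone.
apply: eq_bigl => z; rewrite base_cone eqxx andbT sub_cone base_cone dim_cone.
by congr (_ && _); apply/eqP/eqP; lia.
Qed.

Lemma sum_base n (z : {vspace 'rV[K]_n}) B (phi : {vspace 'rV[K]_n.+1} -> F) :
    row_free B -> rowspan B = z ->
  \sum_(x : subsp K n.+1 (\dim z) | base (val x) == z) phi (val x) =
    \sum_(c : 'cV_(\dim z)) phi (graph B c).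
Proof.
move=> freeB Bz; rewrite (sum_subsp _ (fun x => base x == z) phi).
rewrite (reindex_omap (graph B) (fun U => [pick c | graph B c == U])).
  apply: eq_bigl => c; rewrite dim_graph // base_graph Bz !eqxx /=.
  case: pickP => [c' /eqP/(graph_inj freeB)->|/(_ c)]; first by rewrite eqxx.
  by rewrite eqxx.
move=> U /andP[/eqP[dU] /eqP bU]; case: pickP => [c /eqP /= -> //|noc].
have [c Uc] : exists c, U = graph B c by apply: graph_of_base => //; rewrite bU.
by have := noc c; rewrite -Uc eqxx.
Qed.

(** Extension by 0 to subspaces of every dimension, so that [u] can be evaluated at a cone or a
    graph without a dimension proof inside the term. *)
Definition extend n k (u : fg_M F K n k) (U : {vspace 'rV[K]_n}) : F :=
  \sum_(x : subsp K n k | val x == U) u x.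

Lemma extend_val n k (u : fg_M F K n k) x : extend u (val x) = u x.
Proof. by rewrite /extend (big_pred1 x) // => y; rewrite val_eqE. Qed.

Lemma extend_linear n k a (u v : fg_M F K n k) U :
  extend (a *: u + v) U = a * extend u U + extend v U.
Proof.
rewrite /extend mulr_sumr -big_split.
by apply: eq_bigr => x _; rewrite !ffunE.
Qed.

Lemma extend_act n k (u : fg_M F K n k) g U :
  extend (fg_act _ u g) (vs_act U g) = extend u U.
Proof.
rewrite /extend (reindex_inj (@subsp_act_inj _ n k g)) /=.
apply: eq_big => [x|x _]; last by rewrite ffunE -subsp_actM mulgV subsp_act1.
by rewrite !eqEsubv !vs_actS.
Qed.

Lemma extend_cone_inc n k (u : fg_M F K n.+1 k) (z : subsp K n (k - 1 - 1)) :
  extend (fg_inc F K n.+1 k u) (cone (val z)) =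
    \sum_(y : subsp K n (k - 1) | (val z <= val y)%VS) extend u (cone (val y)).
Proof.
have dz : (\dim (cone (val z)))%:Z == k - 1.
  by rewrite dim_cone; have /eqP := valP z; lia.
rewrite -[cone (val z)]/(val (Sub (cone (val z)) dz : subsp K n.+1 (k - 1))).
rewrite extend_val ffunE -(sum_cone k _ (extend u)).
by apply: eq_bigr => x _; rewrite extend_val.
Qed.

End Sums.

(** * Sums over the graphs above a subspace *)

Section GraphSum.
Variables (K : finFieldType) (F : fieldType).
Hypothesis q_neq0 : #|K|%:R != 0 :> F.
Local Notation q := (#|K|%:R : F).

(* If U is the graph {(f w, w) : w in z} of a linear form f on z = base U, this
   is unit_diff (f w) for w in z. It vanishes if U contains the apex. *)
Definition apex_diff n (w : 'rV[K]_n) (U : {vspace 'rV[K]_n.+1}) : F :=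
  (cons_row 1 w \in U)%:R - (cons_row 0 w \in U)%:R.

(** This is S u (w, z). When z has dimension k, only graphs over z occur in the sum. *)
Definition graph_sum n k (u : fg_M F K n.+1 k) (w : 'rV[K]_n) (z : {vspace 'rV[K]_n}) : F :=
  \sum_(x : subsp K n.+1 k | base (val x) == z) u x * apex_diff w (val x).

Lemma apex_diff_graph n d (B : 'M[K]_(d, n)) x c : row_free B ->
  apex_diff (x *m B) (graph B c) = unit_diff F (pairing x c).
Proof.
by move=> freeB; rewrite /apex_diff !mem_graph // /unit_diff eq_sym [0 == _]eq_sym.
Qed.

Lemma graph_sum_linear n k a (u v : fg_M F K n.+1 k) w z :
  graph_sum (a *: u + v) w z = a * graph_sum u w z + graph_sum v w z.
Proof.
rewrite /graph_sum mulr_sumr -big_split.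
by apply: eq_bigr => x _; rewrite !ffunE mulrDl -mulrA.
Qed.

Lemma graph_sum_act n k (u : fg_M F K n.+1 k) w z (g : GL K n) :
  graph_sum (fg_act _ u (GL_embed g)) w z =
    graph_sum u (w *m val g^-1%g) (vs_act z g^-1%g).
Proof.
rewrite /graph_sum (reindex_inj (@subsp_act_inj _ n.+1 k (GL_embed g))) /=.
apply: eq_big => [x|x _].
  by rewrite base_act -[in RHS](inj_eq (@vs_act_inj _ n g)) -vs_actM mulVg vs_act1.
rewrite ffunE -subsp_actM mulgV subsp_act1; congr (_ * _).
by rewrite /apex_diff !mem_act_embed.
Qed.

Lemma graph_sum_graph n (z : {vspace 'rV[K]_n}) (B : 'M_(\dim z, n))
    (u : fg_M F K n.+1 (\dim z)) (x : 'rV_(\dim z)) :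
    row_free B -> rowspan B = z ->
  graph_sum u (x *m B) z =
    \sum_c extend u (graph B c) * unit_diff F (pairing x c).
Proof.
move=> freeB Bz; rewrite /graph_sum.
under eq_bigr do rewrite -extend_val.
rewrite (sum_base (fun U => extend u U * apex_diff (x *m B) U) freeB Bz).
by apply: eq_bigr => c _; rewrite apex_diff_graph.
Qed.

(** For w = 0 each of the q^(dim z) graphs contributes -1. For w <> 0, evaluation at w is a nonzero
    linear form in the column [c], so [sum_pairing] reduces the sum to that of [unit_diff] over [K],
    which is 0. *)
Lemma sum_apex_diff n (z : {vspace 'rV[K]_n}) w k : w \in z -> k = (\dim z)%:Z ->
  \sum_(x : subsp K n.+1 k | base (val x) == z) apex_diff w (val x) =
    - (w == 0)%:R * q ^+ \dim z.
Proof.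
move=> wz ->; have [B freeB Bz] := rowspan_basis z.
rewrite (sum_base (apex_diff w) freeB Bz).
move: wz; rewrite -{1}Bz => /mem_rowspanP[x ->].
under eq_bigr do rewrite apex_diff_graph //.
have -> : (x *m B == 0) = (x == 0).
  by rewrite -(inj_eq (row_free_inj freeB)) mul0mx.
have [->|x0] := eqVneq x 0.
  rewrite (eq_bigr (fun=> -1)) => [|c _].
    by rewrite sumr_const card_mx muln1 -[_ *+ (_ ^ _)]mulr_natr natrX mulN1r.
  by rewrite /pairing mul0mx mxE unit_diff0.
rewrite oppr0 mul0r (reindex (@trmx K 1 (\dim z))) /=; last first.
  by apply: onW_bij; exists trmx; apply: trmxK.
have xT0 : x^T != 0 by rewrite -(inj_eq trmx_inj) trmxK trmx0.
rewrite -[RHS](mulr0 (q ^+ \dim z / q)) -[X in _ = _ * X](sum_unit_diff K F).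
rewrite -(sum_pairing q_neq0 (unit_diff F) xT0).
by apply: eq_bigr => y _; rewrite -pairing_tr trmxK.
Qed.

(** After exchanging the sums, fix [x] and collect the y inside [x] with base z. If [x] contains the
    apex, such y exist only for x = cone z, which contains every graph over z: [sum_apex_diff] gives
    the correction term. If [x] is a graph, there is one such y when z lies in [base x], and none
    otherwise. *)
Lemma graph_sum_inc n k (u : fg_M F K n.+1 k) w z :
    (\dim z)%:Z = k - 1 -> w \in z ->
  graph_sum (fg_inc F K n.+1 k u) w z =
    \sum_(y : subsp K n k | (z <= val y)%VS) graph_sum u w (val y)
    - (w == 0)%:R * q ^+ \dim z * extend u (cone z).
Proof.
move=> dz wz; rewrite /graph_sum.
transitivity (\sum_x u x * \sum_(y : subsp K n.+1 (k - 1) |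
    (base (val y) == z) && (val y <= val x)%VS) apex_diff w (val y)).
  under eq_bigr do rewrite ffunE mulr_suml.
  rewrite (exchange_big_dep xpredT) //=.
  by apply: eq_bigr => x _; rewrite mulr_sumr.
rewrite (exchange_big_dep xpredT) //= /extend mulr_sumr -sumrN.
rewrite [X in _ = _ + X]big_mkcond -big_split; apply: eq_bigr => x _ /=.
have [ax|ax] := boolP (apex K n \in val x).
  rewrite [X in _ = X + _]big1 => [|y /andP[_ /eqP bxy]]; last first.
    by move: (dim_neq_base x); rewrite bxy (valP y) ax.
  rewrite add0r; have [xz|xz] := eqVneq (val x) (cone z).
    rewrite (eq_bigl (fun y : subsp K n.+1 (k - 1) => base (val y) == z)); last first.
      by move=> y; apply: andb_idr => /eqP by_z; rewrite xz sub_cone by_z.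
    by rewrite sum_apex_diff // mulrC !mulNr.
  rewrite big_pred0 ?mulr0 // => y; apply/andP=> -[/eqP byz yx]; case/eqP: xz.
  rewrite -[LHS]cone_base //; congr cone; apply/esym/eqP.
  rewrite eqEdim -{1}byz baseS //=.
  by rewrite -lez_nat dz (dim_base_subsp ax).
rewrite ifN ?addr0; last by apply: contraNN ax => /eqP xz; rewrite (xz : val x = _) apex_cone.
have [zx|zx] := boolP (z <= base (val x))%VS; last first.
  rewrite [RHS]big_pred0 => [|y]; last first.
    by apply/andP=> -[zy /eqP xy]; rewrite xy zy in zx.
  rewrite big_pred0 ?mulr0 // => y; apply/andP=> -[/eqP yz yx].
  by rewrite -yz baseS in zx.
have dbx : (\dim (base (val x)))%:Z == k by rewrite dim_neq_base.
rewrite (big_pred1 (Sub (base (val x)) dbx)) => [|y]; last first.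
  apply/andP/eqP=> [[_ /eqP xy]|->]; last by rewrite /= zx.
  by apply/val_inj.
(* The graph of the restriction to z of the form defining [x]; at [w] in z both forms take the same
   value. *)
pose y0 := (val x :&: cone z)%VS.
have by0 : base y0 = z.
  apply/vspaceP=> t; apply/mem_baseP/idP=> [[a]|tz].
    by rewrite memv_cap mem_cone => /andP[].
  have /mem_baseP[a ax_t] : t \in base (val x) by apply: subvP tz.
  by exists a; rewrite memv_cap mem_cone ax_t.
have dy0 : (\dim y0)%:Z == k - 1.
  rewrite -dz -by0 dim_base // /y0 memv_cap negb_and ax //.
rewrite (big_pred1 (Sub y0 dy0)) => [|y]; last first.
  apply/andP/eqP=> [[/eqP yz yx]|->]; last by rewrite /= by0 eqxx capvSl.
  apply/val_inj/eqP; rewrite eqEdim /= subv_cap yx sub_cone yz subvv /=.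
  by rewrite -lez_nat (eqP dy0) (eqP (valP y)).
by congr (_ * _); rewrite /apex_diff /= !memv_cap !mem_cone wz !andbT.
Qed.

End GraphSum.

HB.instance Definition _ (F : fieldType) (gT : finGroupType) (M N : fgmod F gT)
    (f : fghom M N) :=
  GRing.isLinear.Build F M N *:%R (fg_map f) (fg_map_linear f).

(** * Inversion of the transform S *)

Section Inversion.
Variables (K : finFieldType) (F : fieldType) (n : nat).
Hypothesis q_neq0 : #|K|%:R != 0 :> F.
Local Notation q := (#|K|%:R : F).

(** Writing [graph_sum] as a sum over columns and exchanging the sums leaves the kernel of
    [sum_pairing_dual], a multiple of the delta at [c]. *)
Lemma graph_sum_inversion (z : {vspace 'rV[K]_n}) (B : 'M_(\dim z, n))
    (u : fg_M F K n.+1 (\dim z)) (c : 'cV_(\dim z)) :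
    row_free B -> rowspan B = z ->
  \sum_t unit_dual F (pairing t c) * graph_sum u (t *m B) z =
    q ^+ \dim z / q * extend u (graph B c).
Proof.
move=> freeB Bz.
under eq_bigr do rewrite graph_sum_graph // mulr_sumr.
rewrite exchange_big /=.
transitivity (\sum_c' (c' == c)%:R * (q ^+ \dim z / q * extend u (graph B c'))).
  apply: eq_bigr => c' _; rewrite mulrA [_%:R * _]mulrC -sum_pairing_dual // mulr_suml.
  by apply: eq_bigr => t _; ring.
rewrite (bigD1 c) //= eqxx mul1r big1 ?addr0 // => c' /negPf->.
by rewrite mul0r.
Qed.

Lemma graph_sum_inj k (u : fg_M F K n.+1 k) :
    (forall (z : subsp K n k) w, w \in val z -> graph_sum u w (val z) = 0) ->
    (forall y : subsp K n (k - 1), extend u (cone (val y)) = 0) ->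
  u = 0.
Proof.
move=> u1 u2; apply/ffunP=> x; rewrite ffunE -extend_val.
have [ax|ax] := boolP (apex K n \in val x).
  have bx : (\dim (base (val x)))%:Z == k - 1 by rewrite dim_base_subsp.
  by have := u2 (Sub (base (val x)) bx); rewrite /= cone_base.
have kE : k = (\dim (base (val x)))%:Z by apply/esym/eqP; rewrite dim_neq_base.
have dx : \dim (val x) = \dim (base (val x)) by rewrite dim_base.
(* The subspace is generalized so that the index [k] can be replaced by the dimension of its base,
   the form in which the inversion formula is stated. *)
move: (val x) dx kE {ax} => U dU kE; move: u u1 {u2}; rewrite {}kE => u u1.
have [B freeB Bz] := rowspan_basis (base U).
have [c Uc] : exists c, U = graph B c by apply: graph_of_base.
have r0 : q ^+ \dim (base U) / q != 0 by rewrite mulf_neq0 ?invr_eq0 ?expf_neq0.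
rewrite [X in extend u X]Uc; apply: (mulfI r0); rewrite mulr0.
rewrite -graph_sum_inversion // big1 // => t _.
rewrite (u1 (Sub (base U) (eqxx (\dim (base U))%:Z))) ?mulr0 //=.
by rewrite -{2}Bz; apply/mem_rowspanP; exists t.
Qed.

Lemma sum_rowspan d (B : 'M[K]_(d, n)) (phi : 'rV[K]_n -> F) : row_free B ->
  \sum_(w in rowspan B) phi w = \sum_t phi (t *m B).
Proof.
move=> freeB; rewrite (reindex_omap (fun t => t *m B) (fun w => [pick t | t *m B == w])).
  apply: eq_bigl => t; rewrite (introT (mem_rowspanP _ _)) /=; last by exists t.
  case: pickP => [t' /eqP/(row_free_inj freeB)->|/(_ t)]; first by rewrite eqxx.
  by rewrite eqxx.
move=> w /mem_rowspanP[t wt]; case: pickP => [t' /eqP/= -> //|/(_ t)].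
by rewrite wt eqxx.
Qed.

(** Values on cones and values of S on pairs with w in z can be prescribed independently, since
    cones and graphs are disjoint families and the kernel is invertible over each z. *)
Lemma graph_sum_surj k (J : 'rV[K]_n -> {vspace 'rV[K]_n} -> F) (b : {vspace 'rV[K]_n} -> F) :
  exists u : fg_M F K n.+1 k,
    (forall (z : subsp K n k) w, w \in val z -> graph_sum u w (val z) = J w (val z)) /\
    (forall y : subsp K n (k - 1), extend u (cone (val y)) = b (val y)).
Proof.
(* On graphs this is the inversion formula applied to [J]: if U is the graph of f, the bracket is
   [unit_dual] at f w. *)
pose f (U : {vspace 'rV[K]_n.+1}) : F := if apex K n \in U then b (base U) else
  q / q ^+ \dim (base U) * \sum_(w in base U) ((cons_row 1 w \in U)%:R - q^-1) * J w (base U).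
exists [ffun x => f (val x)]; split=> [z w wz|y]; last first.
  have dy : (\dim (cone (val y)))%:Z == k.
    by rewrite dim_cone; have /eqP := valP y; lia.
  rewrite -[cone _]/(val (Sub (cone (val y)) dy : subsp K n.+1 k)) extend_val ffunE /f /=.
  by rewrite apex_cone base_cone.
have kE : k = (\dim (val z))%:Z by apply/esym/eqP/(valP z).
move: (val z) kE wz => {}z -> {k}.
have [B freeB Bz] := rowspan_basis z.
rewrite -{1}Bz => /mem_rowspanP[t ->]; rewrite graph_sum_graph //.
have sum_z phi : \sum_(w in z) phi w = \sum_t phi (t *m B) :> F.
  by rewrite -sum_rowspan // Bz.
transitivity (\sum_t' (t == t')%:R * J (t' *m B) z).
  2: rewrite (bigD1 t) //= eqxx mul1r big1 ?addr0 // => t' /negPf t't.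
  2: by rewrite eq_sym t't mul0r.
transitivity (\sum_c \sum_t' q / q ^+ \dim z * J (t' *m B) z *
    (unit_diff F (pairing t c) * unit_dual F (pairing t' c))).
  apply: eq_bigr => c _.
  have dc : (\dim (graph B c))%:Z == (\dim z)%:Z by rewrite dim_graph.
  rewrite -[X in extend _ X]/(val (Sub (graph B c) dc : subsp K n.+1 (\dim z))) extend_val ffunE.
  rewrite /= /f (negPf (apex_graph _ _)) // base_graph Bz sum_z.
  rewrite mulr_sumr mulr_suml; apply: eq_bigr => t' _.
  by rewrite mem_graph // /unit_dual eq_sym; ring.
rewrite exchange_big /=; apply: eq_bigr => t' _.
rewrite -mulr_sumr sum_pairing_dualr //; set delta := _%:R.
have r0 : q ^+ \dim z != 0 by rewrite expf_neq0.
by field; rewrite r0 q_neq0.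
Qed.

End Inversion.

(** * The components of the restricted module *)

Section Components.
Variables (K : finFieldType) (F : fieldType) (n : nat).
Local Notation q := (#|K|%:R : F).
Local Notation Mres k := (fg_pull (GL_embed_morphism K n) (fg_M F K n.+1 k)).
Local Notation M k := (fg_M F K n k).
Implicit Type k : int.

Lemma fg_incX0 F' n' k (u : fg_M F' K n' k) : fg_incX F' K n' 0 k k u = u.
Proof. exact: fg_transp_id. Qed.

Lemma fg_incXS F' n' e k l (u : fg_M F' K n' k) :
  fg_incX F' K n' e.+1 k l u = fg_incX F' K n' e (k - 1) l (fg_inc F' K n' k u).
Proof. by []. Qed.

(** At w = 0 every graph has [apex_diff] equal to -1, so with this sign the value at z is the plain
    sum of [u] over the graphs above z. *)
Definition flat_fun k (u : Mres k) : M k := [ffun z => - graph_sum u 0 (val z)].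

Lemma flat_linear k : linear (@flat_fun k).
Proof.
by move=> a u v; apply/ffunP=> z; rewrite !ffunE graph_sum_linear opprD -mulrN.
Qed.

Lemma flat_act k u g :
  flat_fun (fg_act (Mres k) u g) = fg_act (M k) (flat_fun u) g.
Proof. by apply/ffunP=> z; rewrite !ffunE graph_sum_act mul0mx. Qed.

Definition flat k : fghom (Mres k) (M k) := FGHom (@flat_linear k) (@flat_act k).

Definition apical_fun k (u : Mres k) : M (k - 1) := [ffun y => extend u (cone (val y))].

Lemma apical_linear k : linear (@apical_fun k).
Proof. by move=> a u v; apply/ffunP=> y; rewrite !ffunE extend_linear. Qed.

Lemma apical_act k u g :
  apical_fun (fg_act (Mres k) u g) = fg_act (M (k - 1)) (apical_fun u) g.
Proof.
apply/ffunP=> y; rewrite !ffunE -(extend_act u (GL_embed g)) cone_act /=.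
by rewrite -vs_actM mulVg vs_act1.
Qed.

Definition apical k : fghom (Mres k) (M (k - 1)) :=
  FGHom (@apical_linear k) (@apical_act k).

Lemma apical_inc k (u : Mres k) :
  apical (k - 1) (fg_inc F K n.+1 k u) = fg_inc F K n (k - 1) (apical k u).
Proof.
apply/ffunP=> z; rewrite !ffunE extend_cone_inc.
by apply: eq_bigr => y _; rewrite ffunE.
Qed.

Lemma apical_incX e k l (u : Mres k) : l = k - e%:Z ->
  apical l (fg_incX F K n.+1 e k l u) = fg_incX F K n e (k - 1) (l - 1) (apical k u).
Proof.
elim: e k u => [|e IHe] k u lE.
  by rewrite subr0 in lE; subst l; rewrite !fg_incX0.
by rewrite !fg_incXS IHe; [rewrite apical_inc | lia].
Qed.

(** [fg_incX] is defined by splitting off the factor applied first; here the one applied last is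
    absorbed. *)
Lemma fg_inc_incX e k l u : l = k - e%:Z ->
  fg_inc F K n l (fg_incX F K n e k l u) = fg_incX F K n e.+1 k (l - 1) u.
Proof.
elim: e k u => [|e IHe] k u lE.
  by rewrite subr0 in lE; subst l; rewrite fg_incXS !fg_incX0.
by rewrite !fg_incXS IHe //; lia.
Qed.

Hypothesis q_neq0 : #|K|%:R != 0 :> F.

(** The case w = 0 of [graph_sum_inc]: its correction term, with dim z = k - 1, feeds the apical
    component into the flat one. *)
Lemma flat_inc k (u : Mres k) :
  flat (k - 1) (fg_inc F K n.+1 k u) =
    fg_inc F K n k (flat k u) + q ^ (k - 1) *: apical k u.
Proof.
apply/ffunP=> z; have /eqP dz := valP z.
rewrite !ffunE (graph_sum_inc q_neq0) ?mem0v // eqxx mul1r opprB addrC -sumrN.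
congr (_ + _); first by apply: eq_bigr => y _; rewrite ffunE.
by rewrite -[q ^+ _]/(q ^ (\dim (val z))%:Z) dz.
Qed.

(* Here q ^ _ is an integer power, as k may be less than e. *)
Definition incX_coef k (e : nat) : F := q ^ (k - e%:Z) * (qnum #|K| e)%:R.

Lemma incX_coefS k e : incX_coef k e.+1 = q ^ (k - 1) + incX_coef (k - 1) e.
Proof.
rewrite /incX_coef /qnum big_ord_recr /= natrD natrX mulrDr addrC; congr (_ + _).
  by rewrite -[q ^+ e]/(q ^ e%:Z) -expfzDr //; congr (_ ^ _); lia.
by congr (_ ^ _ * _); lia.
Qed.

(** The passage from the apical to the flat component occurs at one of the [e] steps; the powers
    q^(k-1), ..., q^(k-e) add up to [incX_coef k e]. *)
Lemma flat_incX e k l (u : Mres k) : l = k - e%:Z ->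
  flat l (fg_incX F K n.+1 e k l u) =
    fg_incX F K n e k l (flat k u)
    + incX_coef k e *: fg_incX F K n e.-1 (k - 1) l (apical k u).
Proof.
elim: e k u => [|e IHe] k u lE.
  rewrite /incX_coef /qnum big_ord0 mulr0 scale0r addr0.
  by rewrite subr0 in lE; subst l; rewrite !fg_incX0.
rewrite fg_incXS IHe; last by lia.
rewrite flat_inc apical_inc linearD linearZ -addrA; congr (_ + _).
rewrite incX_coefS scalerDl; congr (_ + _).
(* For e = 0 the truncated [e.-1] gives the wrong power, but its coefficient contains [0] = 0. *)
case: e {IHe lE} => [|e] //=.
by rewrite /incX_coef /qnum big_ord0 mulr0 !scale0r.
Qed.

End Components.

(** * The summand induced from the affine group *)

Section Induced.
Variables (K : finFieldType) (F : fieldType) (n : nat).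
Local Notation Mres k := (fg_pull (GL_embed_morphism K n.+1) (fg_M F K n.+2 k)).
Local Notation Mind k := (fg_ind (fg_pull (Aff_proj_morphism K n) (fg_M F K n k))).
Implicit Type g : GL K n.+1.

Lemma cons_row_Aff a (w : 'rV[K]_n) (h : subg_of (Aff_group K n)) :
  exists b, cons_row a w *m val (sgval h) = cons_row b (w *m val (Aff_proj h))
    /\ (w = 0 -> b = a).
Proof.
exists (a + pairing w (dlsubmx (val (sgval h) : 'M_(1 + n)))); split; last first.
  by move=> ->; rewrite /pairing mul0mx mxE addr0.
rewrite {1}(AffP (subgP h)) /cons_row (@mul_row_block _ 1 1 n 1 n).
by rewrite mulmx0 add0r mulmx1 [w *m dlsubmx _]mx11_scalar -raddfD.
Qed.

Lemma apex_Aff (h : subg_of (Aff_group K n)) : apex K n *m val (sgval h) = apex K n.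
Proof.
have [b [-> bE]] := cons_row_Aff 1 0 h.
by rewrite mul0mx bE.
Qed.

Lemma cone_Aff (y : {vspace 'rV[K]_n}) (h : subg_of (Aff_group K n)) :
  vs_act (cone y) (sgval h) = cone (vs_act y (Aff_proj h)).
Proof.
apply/eqP; rewrite eqEdim vs_act_dim !dim_cone vs_act_dim leqnn andbT.
apply/subvP=> _ /memv_imgP[v vy ->]; rewrite lfunE /=.
move: vy; have [a ->] := row_consP v; rewrite mem_cone => vy.
by have [b [-> _]] := cons_row_Aff a (drop_head K n v) h; rewrite mem_cone mem_vs_act.
Qed.

(** In the rank decomposition of the row [w], the left factor is a nonzero scalar and the middle one
    is the apex; the scalar is moved into the invertible right factor. *)
Lemma apex_transitive (w : 'rV[K]_n.+1) : w != 0 -> exists g, apex K n *m val g = w.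
Proof.
move=> w0; have r1 : \rank w = 1%N by rewrite rank_rV w0.
pose a := col_ebase w 0 0.
have a0 : a != 0.
  by have := col_ebase_unit w; rewrite [col_ebase w]mx11_scalar unitmxE det_scalar1 unitfE.
have gU : a *: row_ebase w \in unitmx by rewrite unitmxZ ?unitfE // row_ebase_unit.
exists (Sub (a *: row_ebase w) gU) => /=.
rewrite -[RHS](mulmx_ebase w) r1 [col_ebase w]mx11_scalar -/a mul_scalar_mx.
rewrite -scalemxAr -scalemxAl; congr (_ *: (_ *m _)).
apply/rowP=> j; rewrite /apex /cons_row mxE [RHS]mxE.
by case: splitP => i ->; rewrite ?ord1 !mxE.
Qed.

(** Here [apex K n] is the first vector of W = K^(n+1), the base point for the nonzero w, and x in
    K^n stands for a subspace of W / <apex>. The case of interest is l = k - 1; a free [l] avoids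
    casts. *)
Definition moment k l (u : Mres k) g : fg_M F K n l :=
  [ffun x => graph_sum u (apex K n *m val g) (vs_act (cone (val x)) g)].

Lemma moment_subproof k l (u : Mres k) :
  [ffun g => moment l u g] \in
    ind_pred (M := fg_pull (Aff_proj_morphism K n) (fg_M F K n l)).
Proof.
apply/ind_predP=> h g; rewrite !ffunE; apply/ffunP=> x; rewrite !ffunE /= mulmxA apex_Aff.
by rewrite vs_actM cone_Aff -vs_actM mulVg vs_act1.
Qed.

Definition moment_fun k l (u : Mres k) : Mind l :=
  (Sub [ffun g => moment l u g] (moment_subproof l u) :
     ind_car (fg_pull (Aff_proj_morphism K n) (fg_M F K n l))).

Lemma moment_linear k l : linear (@moment_fun k l).
Proof.
move=> a u v; apply/val_inj/ffunP=> g; apply/ffunP=> x.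
by rewrite /= !ffunE graph_sum_linear.
Qed.

Lemma moment_act k l u g :
  moment_fun l (fg_act (Mres k) u g) = fg_act (Mind l) (moment_fun l u) g.
Proof.
apply/val_inj/ffunP=> h; apply/ffunP=> x.
by rewrite /= !ffunE graph_sum_act -vs_actM /= mulmxA.
Qed.

Definition moments k l : fghom (Mres k) (Mind l) :=
  FGHom (@moment_linear k l) (@moment_act k l).

Lemma apex_act_neq0 g : apex K n *m val g != 0.
Proof.
apply: contraNneq (apex_neq0 K n) => ag.
by rewrite -[apex K n](mulmxK (valP g)) ag mul0mx.
Qed.

Hypothesis q_neq0 : #|K|%:R != 0 :> F.

(** As [apex K n *m val g] is nonzero, [graph_sum_inc] has no correction term; the subspaces above a
    cone are again cones. *)
Lemma moment_inc k (u : Mres k) g :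
  moment (k - 1 - 1) (fg_inc F K n.+2 k u : Mres (k - 1)) g =
    fg_inc F K n (k - 1) (moment (k - 1) u g).
Proof.
apply/ffunP=> x; have /eqP dx := valP x; rewrite !ffunE (graph_sum_inc q_neq0).
- rewrite (negPf (apex_act_neq0 g)) !mul0r subr0.
  pose phi z := graph_sum u (apex K n *m val g) (vs_act z g).
  transitivity (\sum_(y : subsp K n.+1 k | (cone (val x) <= val y)%VS) phi (val y)).
    rewrite (reindex_inj (@subsp_act_inj _ n.+1 k g)).
    by apply: eq_bigl => y; rewrite /= vs_actS.
  by rewrite sum_cone; apply: eq_bigr => y _; rewrite ffunE.
- by rewrite vs_act_dim dim_cone -[X in Posz X]addn1 PoszD dx subrK.
- by rewrite mem_vs_act apex_cone.
Qed.

Lemma moment_incX e k l (u : Mres k) g : l = k - e%:Z ->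
  moment (l - 1) (fg_incX F K n.+2 e k l u : Mres l) g =
    fg_incX F K n e (k - 1) (l - 1) (moment (k - 1) u g).
Proof.
elim: e k u => [|e IHe] k u lE.
  by rewrite subr0 in lE; subst l; rewrite !fg_incX0.
by rewrite !fg_incXS IHe; [rewrite moment_inc | lia].
Qed.

Lemma moments_incX e k l k1 l1 (u : Mres k) :
    l = k - e%:Z -> k1 = k - 1 -> l1 = l - 1 ->
  moments l l1 (fg_incX F K n.+2 e k l u) =
    fg_ind_map (fg_pull_map (Aff_proj_morphism K n) (fg_incX F K n e k1 l1)) (moments k k1 u).
Proof.
move=> lE -> ->; apply/val_inj/ffunP=> g.
by rewrite /= !ffunE moment_incX.
Qed.

(** A nonzero w determines g with apex g = w up to left multiplication by the affine group, and the
    condition defining the induced module makes the value independent of the choice. The value 0 is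
    taken at w = 0. *)
Lemma induced_pairs k (v : Mind k) : exists J : 'rV[K]_n.+1 -> {vspace 'rV[K]_n.+1} -> F,
  forall g (x : subsp K n k), J (apex K n *m val g) (vs_act (cone (val x)) g) = val v g x.
Proof.
exists (fun w z => if [pick g : GL K n.+1 | apex K n *m val g == w] is Some g
  then extend (val v g) (base (vs_act z g^-1%g)) else 0) => g x.
case: pickP => [g0 /eqP ag0|/(_ g)]; last by rewrite eqxx.
(* This product fixes the apex, so its first row is (1, 0). *)
have hA : (g0 * g^-1)%g \in Aff_group K n.
  rewrite inE; have ae : apex K n *m val (g0 * g^-1)%g = apex K n.
    by rewrite /= mulmxA ag0 mulmxK ?(valP g).
  rewrite -{1}[val _](@submxK _ 1 n 1 n) /apex /cons_row in ae.
  move: ae; rewrite (@mul_row_block _ 1 1 n 1 n) !mul0mx !addr0 !mul1mx.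
  by case/(@eq_row_mx _ 1 1 n) => -> ->; rewrite !eqxx.
pose h := subg (Aff_group K n) (g0 * g^-1)%g.
have hE : sgval h = (g0 * g^-1)%g by rewrite subgK.
have /(_ h g) := elimT (ind_predP _) (valP v); rewrite hE mulgKV => <-.
rewrite ffunE -vs_actM.
have -> : (g * g0^-1)%g = sgval h^-1%g by rewrite -[RHS]/((sgval h)^-1)%g hE invMg invgK.
rewrite cone_Aff base_cone -extend_val; congr (extend _ (vs_act _ _)).
exact: morphV (in_setT h).
Qed.

End Induced.

(** * Diagonalization *)

Section Homs.
Variables (F : fieldType) (gT : finGroupType).
Implicit Types M N P : fgmod F gT.

Definition fg_pair_fun M N P (f : fghom M N) (g : fghom M P) (u : M) : fg_sum N P := (f u, g u).
Lemma fg_pair_linear M N P (f : fghom M N) (g : fghom M P) : linear (fg_pair_fun f g).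
Proof. by move=> a u v; rewrite /fg_pair_fun !linearP. Qed.
Lemma fg_pair_act M N P (f : fghom M N) (g : fghom M P) u x :
  fg_pair_fun f g (fg_act M u x) = fg_act (fg_sum N P) (fg_pair_fun f g u) x.
Proof. by rewrite /fg_pair_fun !fg_map_act. Qed.
Definition fg_pair M N P (f : fghom M N) (g : fghom M P) : fghom M (fg_sum N P) :=
  FGHom (fg_pair_linear f g) (fg_pair_act f g).

Definition fg_addZ_fun M N (f : fghom M N) a (g : fghom M N) (u : M) : N := f u + a *: g u.
Lemma fg_addZ_linear M N (f : fghom M N) a (g : fghom M N) : linear (fg_addZ_fun f a g).
Proof.
by move=> b u v; rewrite /fg_addZ_fun !linearP /= !scalerDr !scalerA addrACA.
Qed.
Lemma fg_addZ_act M N (f : fghom M N) a (g : fghom M N) u x :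
  fg_addZ_fun f a g (fg_act M u x) = fg_act N (fg_addZ_fun f a g u) x.
Proof. by rewrite /fg_addZ_fun !fg_map_act [in RHS]addrC fg_act_linear addrC. Qed.
Definition fg_addZ M N (f : fghom M N) a (g : fghom M N) : fghom M N :=
  FGHom (fg_addZ_linear f a g) (fg_addZ_act f a g).

Definition fg_null_fun M N (u : M) : N := 0.
Lemma fg_null_linear M N : linear (@fg_null_fun M N).
Proof. by move=> a u v; rewrite /fg_null_fun scaler0 addr0. Qed.
Lemma fg_null_act M N u x :
  @fg_null_fun M N (fg_act M u x) = fg_act N (@fg_null_fun M N u) x.
Proof.
rewrite /fg_null_fun; have := @fg_act_linear _ _ N x (-1) 0 0.
by rewrite scaler0 addr0 scaleN1r addNr => ->.
Qed.
Definition fg_null M N : fghom M N := FGHom (@fg_null_linear M N) (@fg_null_act M N).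

Lemma fghom_bij M N (f : fghom M N) :
  (forall u, f u = 0 -> u = 0) -> (forall v, exists u, f u = v) -> bijective f.
Proof.
move=> f0 fsurj; have fsurjb v : exists u, f u == v by have [u <-] := fsurj v; exists u.
exists (fun v => xchoose (fsurjb v)) => [u|v]; last exact/eqP/(xchooseP (fsurjb v)).
apply/eqP; rewrite -subr_eq0; apply/eqP/f0.
by rewrite linearB /= (eqP (xchooseP (fsurjb (f u)))) subrr.
Qed.
End Homs.

Lemma fg_mapD (F : fieldType) (gT : finGroupType) (M N : fgmod F gT) (f : fghom M N) u v :
  f (u + v) = f u + f v.
Proof. exact: linearD. Qed.

Lemma fg_mapZ (F : fieldType) (gT : finGroupType) (M N : fgmod F gT) (f : fghom M N) a u :
  f (a *: u) = a *: f u.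
Proof. exact: linearZ. Qed.

Lemma fg_map0 (F : fieldType) (gT : finGroupType) (M N : fgmod F gT) (f : fghom M N) :
  f 0 = 0.
Proof. exact: linear0. Qed.

Section Mix.
Variables (K : finFieldType) (F : fieldType) (n : nat).
Hypothesis q_neq0 : #|K|%:R != 0 :> F.
Local Notation q := (#|K|%:R : F).
Local Notation Mres k := (fg_pull (GL_embed_morphism K n) (fg_M F K n.+1 k)).
Local Notation M k := (fg_M F K n k).
Local Notation dflat k := (fg_comp (fg_inc F K n k) (flat K F n k)).
Variable c : F.
Hypothesis c_neq0 : c != 0.

(* On the flat and the apical components the incidence map is
   (a, b) |-> (d a + q^(k-1) b, d b); in these coordinates its powers become
   diagonal. *)
Definition mix_even k a1 a2 : fghom (Mres k) (fg_sum (M a1) (M a2)) :=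
  fg_pair (fg_comp (fg_transp F K n k a1) (flat K F n k))
    (fg_comp (fg_transp F K n (k - 1) a2) (fg_addZ (apical K F n k) c^-1 (dflat k))).

(** The scaling of the second coordinate by c^-1 is the one that makes [mix_even_step] hold without
    constants. The transports are identities for a1 = k - 1 and a2 = k. *)
Definition mix_odd k a1 a2 : fghom (Mres k) (fg_sum (M a1) (M a2)) :=
  fg_pair (fg_comp (fg_transp F K n (k - 1) a1) (fg_addZ (dflat k) (- c) (apical K F n k)))
    (fg_comp (fg_transp F K n k a2) (fg_addZ (fg_null _ _) c^-1 (flat K F n k))).

Lemma mix_evenE k (u : Mres k) :
  mix_even k k (k - 1) u =
    (flat K F n k u, apical K F n k u + c^-1 *: fg_inc F K n k (flat K F n k u)).
Proof. by congr (_, _); apply: fg_transp_id. Qed.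

Lemma mix_oddE k (u : Mres k) :
  mix_odd k (k - 1) k u =
    (fg_inc F K n k (flat K F n k u) - c *: apical K F n k u, c^-1 *: flat K F n k u).
Proof.
congr (_, _); first by rewrite -scaleNr; apply: fg_transp_id.
by rewrite -[RHS]add0r; apply: fg_transp_id.
Qed.

(** The image has components d^(e+1) a + c d^e b and d^(e+1) b. In the first coordinate of [mix_odd]
    the b terms cancel; in the second, d^e factors out. *)
Lemma mix_even_step e e1 e2 k l a1 a2 b1 b2 (u : Mres k) :
    e1 = e.+1 -> e2 = e.+2 -> l = k - e1%:Z -> a1 = k -> a2 = k - 1 -> b1 = l - 1 -> b2 = l ->
    incX_coef K F k e1 = c ->
  mix_odd l b1 b2 (fg_incX F K n.+1 e1 k l u) =
    (fg_incX F K n e2 a1 b1 (mix_even k a1 a2 u).1,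
     fg_incX F K n e a2 b2 (mix_even k a1 a2 u).2).
Proof.
move=> -> -> lE -> -> -> -> cE; rewrite mix_evenE mix_oddE.
set a := flat K F n k u; set b := apical K F n k u.
have aE := flat_incX q_neq0 u lE; have bE := apical_incX u lE.
have lE' : l = k - 1 - e%:Z by lia.
rewrite cE -/a -/b in aE bE; congr (_, _).
  rewrite bE aE fg_mapD fg_mapZ.
  by rewrite (fg_inc_incX a lE) (fg_inc_incX b lE') addrK.
rewrite aE scalerDr scalerA mulVf // scale1r addrC fg_mapD fg_mapZ.
by congr (_ + _).
Qed.

(** With coefficient -c the roles are exchanged: d^e factors out of the first coordinate, and the b
    terms cancel in the second. *)
Lemma mix_odd_step e e1 e2 k l a1 a2 b1 b2 (u : Mres k) :
    e1 = e.+1 -> e2 = e.+2 -> l = k - e1%:Z -> a1 = k - 1 -> a2 = k -> b1 = l -> b2 = l - 1 ->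
    incX_coef K F k e1 = - c ->
  mix_even l b1 b2 (fg_incX F K n.+1 e1 k l u) =
    (fg_incX F K n e a1 b1 (mix_odd k a1 a2 u).1,
     fg_incX F K n e2 a2 b2 (mix_odd k a1 a2 u).2).
Proof.
move=> -> -> lE -> -> -> -> cE; rewrite mix_evenE mix_oddE.
set a := flat K F n k u; set b := apical K F n k u.
have aE := flat_incX q_neq0 u lE; have bE := apical_incX u lE.
have lE' : l = k - 1 - e%:Z by lia.
rewrite cE -/a -/b in aE bE; congr (_, _).
  by rewrite aE fg_mapD -!scaleNr fg_mapZ.
rewrite bE aE fg_mapD fg_mapZ.
rewrite (fg_inc_incX a lE) (fg_inc_incX b lE') scalerDr scalerA mulrN mulVf // scaleN1r.
by rewrite [LHS]addrC subrK fg_mapZ.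
Qed.

Lemma mix_even_eq0 k a1 a2 (u : Mres k) : a1 = k -> a2 = k - 1 ->
  mix_even k a1 a2 u = 0 -> flat K F n k u = 0 /\ apical K F n k u = 0.
Proof.
move=> -> ->; rewrite mix_evenE => E.
have a0 : flat K F n k u = 0 := congr1 fst E.
have b0 : apical K F n k u + c^-1 *: fg_inc F K n k (flat K F n k u) = 0 := congr1 snd E.
by split=> //; move: b0; rewrite a0 fg_map0 scaler0 addr0.
Qed.

Lemma mix_odd_eq0 k a1 a2 (u : Mres k) : a1 = k - 1 -> a2 = k ->
  mix_odd k a1 a2 u = 0 -> flat K F n k u = 0 /\ apical K F n k u = 0.
Proof.
move=> -> ->; rewrite mix_oddE => E.
have a0 : flat K F n k u = 0.
  by apply: (scalerI (invr_neq0 c_neq0)); rewrite scaler0; apply: (congr1 snd E).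
have b0 : fg_inc F K n k (flat K F n k u) - c *: apical K F n k u = 0 := congr1 fst E.
split=> //; apply: (scalerI c_neq0); apply: oppr_inj.
by move: b0; rewrite a0 fg_map0 sub0r scaler0 oppr0.
Qed.

(** Only the components are solved for, because [u] must later realize them together with a
    prescribed third component. *)
Lemma mix_even_surj k a1 a2 v : a1 = k -> a2 = k - 1 -> exists a b,
  forall u, flat K F n k u = a -> apical K F n k u = b -> mix_even k a1 a2 u = v.
Proof.
move=> ? ?; subst a1 a2; case: v => v1 v2.
exists v1, (v2 - c^-1 *: fg_inc F K n k v1) => u uE1 uE2.
by rewrite mix_evenE uE1 uE2 subrK.
Qed.

Lemma mix_odd_surj k a1 a2 v : a1 = k - 1 -> a2 = k -> exists a b,
  forall u, flat K F n k u = a -> apical K F n k u = b -> mix_odd k a1 a2 u = v.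
Proof.
move=> ? ?; subst a1 a2; case: v => v1 v2.
exists (c *: v2), (c^-1 *: (fg_inc F K n k (c *: v2) - v1)) => u uE1 uE2.
rewrite mix_oddE uE1 uE2 !scalerA mulfV // mulVf // !scale1r.
by rewrite opprB [X in (X, _)]addrC subrK.
Qed.

End Mix.

(** * q-numbers and assembly of the isomorphism *)

Lemma qnumD q i j : qnum q (i + j) = (qnum q i + q ^ i * qnum q j)%N.
Proof.
elim: j => [|j IHj]; first by rewrite addn0 [qnum q 0]/qnum big_ord0 muln0 addn0.
have qS e : qnum q e.+1 = (qnum q e + q ^ e)%N by rewrite /qnum big_ord_recr.
by rewrite addnS !qS IHj mulnDr addnA -expnD.
Qed.

Lemma qnum_geometric (F : fieldType) q i :
  (q%:R - 1) * (qnum q i)%:R = q%:R ^+ i - 1 :> F.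
Proof.
by rewrite subrX1 /qnum natr_sum; congr (_ * _); apply: eq_bigr => j _; rewrite natrX.
Qed.

Section Assembly.
Variables (K : finFieldType) (F : fieldType) (n m : nat) (k : int) (i : nat).
Hypothesis q_neq0 : #|K|%:R != 0 :> F.
Local Notation q := (#|K|%:R : F).
Hypothesis qm0 : (qnum #|K| m)%:R = 0 :> F.
Hypothesis qi0 : (qnum #|K| i)%:R != 0 :> F.
Hypothesis i_bounds : (0 < i < m)%N.

(** As (q - 1)[m] = q^m - 1, the vanishing of [m] forces q^m = 1. *)
Lemma qX_period (s : int) : q ^ (s * m%:Z) = 1.
Proof.
have qm1 : q ^ m%:Z = 1.
  by apply/eqP; rewrite -subr_eq0 -[q ^ _]/(q ^+ m) -qnum_geometric qm0 mulr0.
by rewrite mulrC -exprz_exp qm1 exp1rz.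
Qed.

Let c : F := q ^ (k - i%:Z) * (qnum #|K| i)%:R.

Lemma mix_coef_neq0 : c != 0.
Proof. by rewrite mulf_neq0 // expfz_neq0. Qed.

Lemma incX_coef_even j : (2 %| j)%Z -> incX_coef K F (seqM_dim m k i j) i = c.
Proof.
move=> j2; rewrite /incX_coef /seqM_dim j2 addrAC expfzDr // qX_period mulr1.
by [].
Qed.

(* [m] = [i] + q^i [m - i] vanishes. *)
Lemma incX_coef_odd j : (2 %| j)%Z = false ->
  incX_coef K F (seqM_dim m k i j) (m - i)%N = - c.
Proof.
move=> j2; rewrite /incX_coef /seqM_dim j2.
have [i0 im] := andP i_bounds.
set s := ((j + 1) %/ 2)%Z.
have -> : k - i%:Z + s * m%:Z - (m - i)%N%:Z = k + (s - 1) * m%:Z.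
  by rewrite -subzn ?(ltnW im) // mulrBl mul1r; lia.
rewrite expfzDr // qX_period mulr1.
have /eqP := qm0; rewrite -{1}(subnKC (ltnW im)) qnumD natrD natrM natrX addrC addr_eq0.
move/eqP=> E; rewrite /c -mulrN -E mulrA; congr (_ * _).
by rewrite -[q ^+ i]/(q ^ i%:Z) -expfzDr // subrK.
Qed.

Local Notation Cres := (fs_pull (GL_embed_morphism K n) (seqM F K n.+1 m k i)).
Local Notation C1 := (seqM F K n m k i.+1).
Local Notation C2 := (seqM F K n m (k - 1) i.-1).

Definition mix (j : int) : fghom (Cres j) (fg_sum (C1 j) (C2 j)) :=
  if (2 %| j)%Z then mix_even K n c (seqM_dim m k i j) _ _
  else mix_odd K n c (seqM_dim m k i j) _ _.

(** As i > 0, (k - 1) - (i - 1) = k - i: the two summands exchange their dimensions with the parity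
    of [j]. *)
Lemma mix_dims j : if (2 %| j)%Z
  then seqM_dim m k i.+1 j = seqM_dim m k i j /\
       seqM_dim m (k - 1) i.-1 j = seqM_dim m k i j - 1
  else seqM_dim m k i.+1 j = seqM_dim m k i j - 1 /\
       seqM_dim m (k - 1) i.-1 j = seqM_dim m k i j.
Proof.
have [i0 im] := andP i_bounds.
by rewrite /seqM_dim; case: (2 %| j)%Z; move: (_ * m%:Z) => t; split; lia.
Qed.

Lemma mix_map j u : mix (j - 1) (fs_map Cres j u) = fs_map (fs_sum C1 C2) j (mix j u).
Proof.
have [i0 im] := andP i_bounds.
have lE := seqM_dim_pred k j (ltnW im).
have := mix_dims j; have := mix_dims (j - 1); rewrite /mix.
rewrite [fs_map _ _ u]/(fg_incX F K n.+1 (seqM_exp m i j) _ _ u).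
set v := fs_map _ _ _.
have -> : v =
  (fg_incX F K n (seqM_exp m i.+1 j) (seqM_dim m k i.+1 j) (seqM_dim m k i.+1 (j - 1))
     (mix j u).1,
   fg_incX F K n (seqM_exp m i.-1 j) (seqM_dim m (k - 1) i.-1 j)
     (seqM_dim m (k - 1) i.-1 (j - 1)) (mix j u).2) by [].
move: {v} lE; rewrite /mix /seqM_exp.
have [j2|/negbTE j2] := boolP (2 %| j)%Z.
  have -> : (2 %| j - 1)%Z = false by lia.
  move=> lE [b1 b2] [a1 a2].
  apply: (mix_even_step q_neq0 mix_coef_neq0) => //; try lia.
  exact: incX_coef_even.
have -> : (2 %| j - 1)%Z by lia.
move=> lE [b1 b2] [a1 a2].
(* Here e = m - i - 1, and e + 2 is m - (i - 1); both truncated subtractions are exact since 0 < i <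
   m. *)
apply: (mix_odd_step q_neq0 mix_coef_neq0) => //; try lia.
exact: incX_coef_odd.
Qed.

(** The third summand is kept abstract to treat the zero sequence and the induced one together. *)
Variables (D : fgseq F (GL K n)) (chi : forall j, fghom (Cres j) (D j)).
Hypothesis chi_map : forall j u, chi (j - 1) (fs_map Cres j u) = fs_map D j (chi j u).
Hypothesis chi_inj : forall j (u : Cres j),
  flat K F n _ u = 0 -> apical K F n _ u = 0 -> chi j u = 0 -> u = 0.
Hypothesis chi_surj : forall j a b v, exists u : Cres j,
  [/\ flat K F n _ u = a, apical K F n _ u = b & chi j u = v].

Lemma mix_iso : fgseq_iso Cres (fs_sum (fs_sum C1 C2) D).
Proof.
exists (fun j => fg_pair (mix j) (chi j)); split=> [j|j u]; last first.
  by congr (_, _); [apply: mix_map | apply: chi_map].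
apply: fghom_bij => [u [u12 u3]|[v12 v3]].
  have [u1 u2] : flat K F n _ u = 0 /\ apical K F n _ u = 0.
    have := mix_dims j; move: u12; rewrite /mix.
    by case: (2 %| j)%Z => u0 [d1 d2];
      [apply: mix_even_eq0 u0 | apply: (mix_odd_eq0 mix_coef_neq0) u0].
  exact: chi_inj u3.
have [a [b abE]] : exists a b, forall u,
    flat K F n _ u = a -> apical K F n _ u = b -> mix j u = v12.
  have := mix_dims j; move: v12; rewrite /mix.
  by case: (2 %| j)%Z => v12 [d1 d2];
    [apply: mix_even_surj | apply: (mix_odd_surj mix_coef_neq0)].
have [u [uE1 uE2 uE3]] := chi_surj a b v3.
by exists u; congr (_, _); [apply: abE | exact: uE3].
Qed.


End Assembly.

(** * The three components determine an element and can be prescribed *)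

Section MomentsBijective.
Variables (K : finFieldType) (F : fieldType).
Hypothesis q_neq0 : #|K|%:R != 0 :> F.

Lemma flat_eq0 n k (u : fg_M F K n.+1 k) (z : subsp K n k) :
  flat K F n k u = 0 -> graph_sum u 0 (val z) = 0.
Proof. by move/ffunP/(_ z); rewrite !ffunE => /eqP; rewrite oppr_eq0 => /eqP. Qed.

Lemma apical_eq0 n k (u : fg_M F K n.+1 k) (y : subsp K n (k - 1)) :
  apical K F n k u = 0 -> extend u (cone (val y)) = 0.
Proof. by move/ffunP/(_ y); rewrite !ffunE. Qed.

(** The flat component gives S at w = 0. By transitivity, a pair with w <> 0 is a translate of
    (apex, cone x), where the moments give S. *)
Lemma moments_inj n k l (u : fg_M F K n.+2 k) : l = k - 1 ->
  flat K F n.+1 k u = 0 -> apical K F n.+1 k u = 0 -> moments K F n k l u = 0 -> u = 0.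
Proof.
move=> -> u1 u2 u3; apply: graph_sum_inj => // [z w wz|y]; last exact: apical_eq0.
have [->|w0] := eqVneq w 0; first exact: flat_eq0.
have [g wE] := apex_transitive w0.
have az : apex K n \in vs_act (val z) g^-1%g.
  by rewrite mem_vs_actV invgK wE.
have dx : (\dim (base (vs_act (val z) g^-1%g)))%:Z == k - 1.
  by have /eqP := valP z; have := dim_base_apex az; rewrite vs_act_dim; lia.
have /(congr1 val)/ffunP/(_ g)/ffunP/(_ (Sub (base (vs_act (val z) g^-1%g)) dx)) := u3.
by rewrite !ffunE /= wE cone_base // -vs_actM mulVg vs_act1.
Qed.

Lemma moments_surj n k l a b v : l = k - 1 -> exists u : fg_M F K n.+2 k,
  [/\ flat K F n.+1 k u = a, apical K F n.+1 k u = b & moments K F n k l u = v].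
Proof.
move=> lE; subst l; have [J JE] := induced_pairs v.
have [u [uJ ub]] := graph_sum_surj q_neq0 k
  (* The sign undoes the one in [flat_fun]. *)
  (fun w z => if w == 0 then - extend a z else J w z) (fun y => extend b y).
exists u; split.
- by apply/ffunP=> z; rewrite ffunE uJ ?mem0v // eqxx opprK extend_val.
- by apply/ffunP=> y; rewrite ffunE ub extend_val.
apply/val_inj/ffunP=> g; apply/ffunP=> x; rewrite !ffunE -JE.
have dz : (\dim (vs_act (cone (val x)) g))%:Z == k.
  by rewrite vs_act_dim dim_cone; have /eqP := valP x; lia.
have := uJ (Sub (vs_act (cone (val x)) g) dz) (apex K n *m val g).
by rewrite /= mem_vs_act apex_cone (negPf (apex_act_neq0 g)) => ->.
Qed.

End MomentsBijective.

Theorem theorem3p1 (K : finFieldType) (F : fieldType) (p : nat)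
    (chFp : p \in [pchar F]) (pNq : ~~ (p %| #|K|)%N)
    (n : nat) (k : int) (i : nat) :
  let m := mpq chFp pNq in
  0 <= k <= n.+1%:Z ->
  (0 < i < m)%N ->
  fgseq_iso
    (fs_pull (GL_embed_morphism K n) (seqM F K n.+1 m k i))
    (fs_sum
       (fs_sum (seqM F K n m k i.+1) (seqM F K n m (k - 1) i.-1))
       (seqM_singer F K n m (k - 1) i)).
Proof.
move=> m _ i_bounds.
have q_neq0 : #|K|%:R != 0 :> F by rewrite -(dvdn_pcharf chFp).
have [qm0 qi0] : (qnum #|K| m)%:R = 0 :> F /\ (qnum #|K| i)%:R != 0 :> F.
  have [i0 im] := andP i_bounds; move: im; rewrite /m /mpq.
  case: ex_minnP => m' /andP[_ /eqP qm0] min_m im; split=> //.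
  (* Minimality of m concerns indices above 1; for i = 1, [1] = 1. *)
  have [i1|] := ltnP 1 i; last first.
    by case: i i0 {im i_bounds} => [|[|]] // _ _; rewrite /qnum big_ord1 oner_eq0.
  by apply: contraTN im => qi; rewrite -leqNgt min_m // i1.
(* For n = 0 the only w is 0, so the flat and apical components suffice and the third summand is
   zero. *)
case: n => [|n].
  apply: (mix_iso (D := seqM_singer F K 0 m (k - 1) i) q_neq0 qm0 qi0 i_bounds
    (chi := fun j => fg_null _ _)) => // [j u u1 u2 _|j a b v].
    apply: graph_sum_inj => // [z w _|y]; last exact: apical_eq0.
    by rewrite [w]thinmx0; apply: flat_eq0.
  have [u [uJ ub]] := graph_sum_surj q_neq0 (seqM_dim m k i j)
    (fun w z => - extend a z) (fun y => extend b y).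
  exists u; split; last by rewrite [LHS]thinmx0 [RHS]thinmx0.
    by apply/ffunP=> z; rewrite ffunE uJ ?mem0v // opprK extend_val.
  by apply/ffunP=> y; rewrite ffunE ub extend_val.
have dimE j : seqM_dim m (k - 1) i j = seqM_dim m k i j - 1.
  by rewrite /seqM_dim; case: ifP => _; move: (_ * m%:Z) => t; lia.
apply: (mix_iso (D := seqM_singer F K n.+1 m (k - 1) i) q_neq0 qm0 qi0 i_bounds
  (chi := fun j => moments K F n (seqM_dim m k i j) (seqM_dim m (k - 1) i j))).
- move=> j u; apply: (moments_incX q_neq0) => //.
  by apply: seqM_dim_pred; have [_ /ltnW] := andP i_bounds.
- by move=> j u; apply: moments_inj.
- by move=> j a b v; apply: moments_surj.
Qed.
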